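(* Let $f\in\mathbb{R}[x,y,z]$ be a homogeneous polynomial of degree $d\ge 1$ whose complex projective plane curve $\mathcal{V}_{\mathbb{C}}(f)\subset\mathbb{P}^2(\mathbb{C})$ is smooth. Suppose $D$ is a real-contact divisor of $\mathcal{V}_{\mathbb{C}}(f)$ of degree $\binom{d}{2}$, and let $A_D=(a_{jk})_{1\le j,k\le d}$ be any matrix resulting from Dixon's construction (described in the context) applied to $D$. (a) Every entry of the adjugate matrix $A_D^{\mathrm{adj}}$ is divisible by $f^{d-2}$, and the matrix $M_D=(1/f^{d-2})A_D^{\mathrm{adj}}$ has linear entries (homogeneous linear forms). Furthermore there exists $\gamma\in\mathbb{R}$ such that $\gamma f=\det(M_D)$. (b) If $f$ is hyperbolic with respect to $e\in\mathbb{R}^3$ and $a_{11}=(A_D)_{11}$ interlaces $f$ with respect to $e$, then $\gamma\ne 0$ and the matrix $M_D(e)$ is (positive or negative) definite.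
   Context: Divisors: $\mathrm{Div}(f)$ is the free abelian group on the complex points of $\mathcal{V}_{\mathbb{C}}(f)$. For $D=\sum n_iP_i\in\mathrm{Div}(f)$, $\deg D=\sum n_i$ and $\overline{D}=\sum n_i\overline{P_i}$ (complex conjugate points). For divisors, $E\ge D$ means all coefficients of $E-D$ are $\ge 0$. For a homogeneous $g\in\mathbb{C}[x,y,z]$ with no common factor with $f$, $f.g=\sum_{P}I_P(f,g)\,P$ is the intersection divisor, where $I_P(f,g)$ is the intersection multiplicity at $P$. A divisor $D\in\mathrm{Div}(f)$ is a real-contact divisor of $\mathcal{V}_{\mathbb{C}}(f)$ if there is a real form $g$ with $f.g=D+\overline{D}$. For a polynomial $q$ with complex coefficients, $\overline{q}$ is obtained by conjugating the coefficients. $\mathbb{C}[x,y,z]_{m}$ denotes the forms of degree $m$ (together with $0$). Dixon's construction of $A_D$: let $D$ be a real-contact divisor of degree $\binom d2$. Let $a_{11}\in\mathbb{R}[x,y,z]_{d-1}$ be such that $f.a_{11}=D+\overline{D}$. Let $V$ be the complex vector space of those $g\in\mathbb{C}[x,y,z]_{d-1}$ with $f.g\ge D$ (including $g=0$). Extend $a_{11}$ to a linearly independent family $a_{11},a_{12},\dots,a_{1d}$ in $V$. For $2\le j\le k\le d$ choose a form $a_{jk}\in\mathbb{C}[x,y,z]_{d-1}$ such that $\overline{a_{1j}}\,a_{1k}-a_{11}a_{jk}$ lies in the ideal $(f)$, with $a_{jj}$ chosen real when $j=k$. Put $a_{kj}=\overline{a_{jk}}$ for $j<k$ and $A_D=(a_{jk})_{j,k}$,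 a Hermitian matrix of forms of degree $d-1$. $A_D$ denotes any matrix obtained in this way. (For $d=1$, $1/f^{d-2}$ means $f$ and $A_D^{\mathrm{adj}}=(1)$, so the divisibility assertion is vacuous.) Hyperbolicity: $f$ is hyperbolic with respect to $e\in\mathbb{R}^3$ if $f(e)\ne0$ and for every $a\in\mathbb{R}^3$ all roots of $f(te+a)\in\mathbb{R}[t]$ are real. Interlacing: for univariate real polynomials $p,q$ of degrees $d,d-1$ with only real zeros $\alpha_1\le\dots\le\alpha_d$ and $\beta_1\le\dots\le\beta_{d-1}$, $q$ interlaces $p$ if $\alpha_i\le\beta_i\le\alpha_{i+1}$ for all $i=1,\dots,d-1$. A real form $g$ of degree $\deg(f)-1$ interlaces $f$ with respect to $e$ if $g(te+a)$ interlaces $f(te+a)$ for every $a\in\mathbb{R}^3$. *)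

(* Defs.v *)
From HB Require Import structures.
From mathcomp Require Import all_boot all_order all_algebra.
From mathcomp Require Import reals.
From mathcomp Require Import complex.
From mathcomp Require Import freeg mpoly.

Set Implicit Arguments.
Unset Strict Implicit.
Unset Printing Implicit Defensive.

Import Order.TTheory GRing.Theory Num.Theory.

Local Open Scope ring_scope.
Local Open Scope sesquilinear_scope.

Section Forms.
Variable R : realType.
Local Notation C := R[i].

Definition complexify (p : {mpoly R[3]}) : {mpoly C[3]} :=
  map_mpoly (real_complex R) p.

Definition conj_mpoly (p : {mpoly C[3]}) : {mpoly C[3]} :=
  map_mpoly (Num.conj : C -> C) p.

Definition mdvd (p q : {mpoly C[3]}) : Prop := exists r, q = r * p.

(* The units of C[x,y,z] are the nonzero constants. *)
Definition no_common_factor (F G : {mpoly C[3]}) : Prop :=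
  forall H, mdvd H F -> mdvd H G -> H \is a GRing.unit.

End Forms.

Section ProjectivePlane.
Variable R : realType.
Local Notation C := R[i].

(* A point of P^2(C) is given by its unique homogeneous coordinate vector whose
   first nonzero entry is 1. *)
Definition normalized (v : 'rV[C]_3) : bool :=
  [exists i : 'I_3,
     (v 0 i == 1) && [forall j : 'I_3, (j < i)%N ==> (v 0 j == 0)]].

Record point := Point { coords :> 'rV[C]_3; _ : normalized coords }.

HB.instance Definition _ := [isSub for coords].
HB.instance Definition _ := [Choice of point by <:].

Lemma normalized_conj (P : point) : normalized (map_mx Num.conj P).
Proof.
case: P => v /= /existsP[i /andP[/eqP vi1 /forallP vj0]].
apply/existsP; exists i; rewrite mxE vi1 conjC1 eqxx /=.
apply/forallP => j; apply/implyP => ji; rewrite mxE.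
by have /implyP/(_ ji)/eqP -> := vj0 j; rewrite conjC0.
Qed.

Definition conj_point (P : point) : point := Point (normalized_conj P).

(* A homogeneous polynomial vanishes at a point of P^2(C) iff it vanishes at the
   chosen coordinate vector. *)
Definition on_curve (F : {mpoly C[3]}) (P : point) : bool := F.@[P 0] == 0.

Definition smooth_curve (F : {mpoly C[3]}) : Prop :=
  forall P : point, on_curve F P -> exists i : 'I_3, (F^`M(i)).@[P 0] != 0.

End ProjectivePlane.

Section Divisors.
Variable R : realType.
Local Notation C := R[i].
Local Notation point := (point R).
Local Notation "x %:F" := (tofrac x).

(* Div(F) as the subgroup of the free abelian group on P^2(C) formed by the
   divisors supported on the curve F = 0. *)
Definition divisor_on (F : {mpoly C[3]}) (D : {freeg point}) : Prop :=
  all (on_curve F) (dom D).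

Definition conj_div (D : {freeg point}) : {freeg point} :=
  fglift (fun P => << conj_point P >> : {freeg point}) D.

(* The local ring of P^2 at P, inside the field C(x,y,z): the quotients of two
   forms of the same degree whose denominator does not vanish at P. *)
Definition local_ring (P : point) (h : {fraction {mpoly C[3]}}) : Prop :=
  exists k (p s : {mpoly C[3]}),
    [/\ p \is k.-homog, s \is k.-homog, s.@[P 0] != 0 & h = p%:F / s%:F].

(* The ideal of the local ring at P generated by the local equations of the
   forms F and G. *)
Definition local_ideal (P : point) (F G : {mpoly C[3]})
    (h : {fraction {mpoly C[3]}}) : Prop :=
  exists k (p s : {mpoly C[3]}),
    [/\ p \is k.-homog, s \is k.-homog, s.@[P 0] != 0, h = p%:F / s%:F
      & exists u v, p = u * F + v * G].

(* I_P(F, G) = n: the C-vector space local_ring P / local_ideal P F G has a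
   basis of n elements. *)
Definition intersection_multiplicity (P : point) (F G : {mpoly C[3]}) (n : nat)
    : Prop :=
  exists2 b : 'I_n -> {fraction {mpoly C[3]}},
    forall i, local_ring P (b i)
  & forall h, local_ring P h ->
      exists! c : 'rV[C]_n,
        local_ideal P F G (h - \sum_i ((c 0 i)%:MP_[3])%:F * b i).

(* F.G = E *)
Definition intersection_divisor (F G : {mpoly C[3]}) (E : {freeg point})
    : Prop :=
  no_common_factor F G /\
  forall P : point,
    exists2 n : nat, intersection_multiplicity P F G n & coeff P E = n%:Z.

Definition real_contact (f : {mpoly R[3]}) (D : {freeg point}) : Prop :=
  divisor_on (complexify f) D /\
  exists m (g : {mpoly R[3]}), g \is m.-homog /\
    intersection_divisor (complexify f) (complexify g) (D + conj_div D).

End Divisors.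

Section Dixon.
Variable R : realType.
Local Notation C := R[i].
Local Notation point := (point R).

(* The space V of forms g of degree d - 1 with F.g >= D, including g = 0. *)
Definition dixon_space (d : nat) (F : {mpoly C[3]}) (D : {freeg point})
    (g : {mpoly C[3]}) : Prop :=
  g \is d.-1.-homog /\
  (g = 0 \/ exists2 E, intersection_divisor F g E & fgle D E).

(* Indices start at 0, so the entry a_11 is A fst_ix fst_ix. *)
Record dixon_matrix (d : nat) (d_gt0 : (0 < d)%N) (f : {mpoly R[3]})
    (D : {freeg point}) (A : 'M[{mpoly C[3]}]_d) : Prop := {
  fst_ix := Ordinal d_gt0 : 'I_d;
  fC := complexify f;
  dixon_a11 : exists a : {mpoly R[3]},
    [/\ a \is d.-1.-homog, A fst_ix fst_ix = complexify a
      & intersection_divisor fC (A fst_ix fst_ix) (D + conj_div D)];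
  dixon_row_space : forall k, dixon_space d fC D (A fst_ix k);
  dixon_row_free : forall c : 'I_d -> C,
    \sum_k c k *: A fst_ix k = 0 -> forall k, c k = 0;
  dixon_upper_homog : forall j k : 'I_d, (0 < j <= k)%N ->
    A j k \is d.-1.-homog;
  dixon_upper_mod : forall j k : 'I_d, (0 < j <= k)%N ->
    mdvd fC (conj_mpoly (A fst_ix j) * A fst_ix k - A fst_ix fst_ix * A j k);
  dixon_diag_real : forall j : 'I_d, (0 < j)%N ->
    exists a : {mpoly R[3]}, A j j = complexify a;
  dixon_lower : forall j k : 'I_d, (j < k)%N -> A k j = conj_mpoly (A j k)
}.

(* M = (1 / F^(d-2)) \adj A; for d = 1 the factor 1 / F^(-1) is F. *)
Definition dixon_quotient (d : nat) (F : {mpoly C[3]})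
    (A M : 'M[{mpoly C[3]}]_d) : Prop :=
  if d == 1%N then M = F *: \adj A else F ^+ (d - 2) *: M = \adj A.

(* The value at a real vector e of a matrix of complex forms. *)
Definition eval_mx (d : nat) (M : 'M[{mpoly C[3]}]_d) (e : 'rV[R]_3)
    : 'M[C]_d :=
  map_mx (fun p => p.@[map_mx (real_complex R) e 0]) M.

Definition definite (d : nat) (M : 'M[C]_d) : Prop :=
  M \is hermsymmx /\
  ((forall v : 'cV[C]_d, v != 0 -> 0 < (v ^t* *m M *m v) 0 0) \/
   (forall v : 'cV[C]_d, v != 0 -> (v ^t* *m M *m v) 0 0 < 0)).

End Dixon.

Section Hyperbolic.
Variable R : realType.
Local Notation C := R[i].

(* The univariate polynomial f(te + a). *)
Definition restrict_line (f : {mpoly R[3]}) (e a : 'rV[R]_3) : {poly R} :=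
  mmap polyC (fun i => e 0 i *: 'X + (a 0 i)%:P) f.

Definition hyperbolic (f : {mpoly R[3]}) (e : 'rV[R]_3) : Prop :=
  f.@[e 0] != 0 /\
  forall (a : 'rV[R]_3) (z : C),
    root (map_poly (real_complex R) (restrict_line f e a)) z ->
    z \is Num.real.

(* alpha and beta are the nondecreasing lists of zeros, with multiplicity. *)
Definition interlaces_poly (q p : {poly R}) : Prop :=
  exists alpha beta : seq R,
    [/\ p != 0 /\ p = lead_coef p *: \prod_(x <- alpha) ('X - x%:P),
        q != 0 /\ q = lead_coef q *: \prod_(x <- beta) ('X - x%:P),
        sorted <=%R alpha /\ sorted <=%R beta,
        size alpha = (size beta).+1
      & forall i, (i < size beta)%N -> alpha`_i <= beta`_i <= alpha`_i.+1].

(* g, of degree d - 1, interlaces f, of degree d, with respect to e. *)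
Definition interlaces (d : nat) (g f : {mpoly R[3]}) (e : 'rV[R]_3) : Prop :=
  g \is d.-1.-homog /\
  forall a : 'rV[R]_3, interlaces_poly (restrict_line g e a) (restrict_line f e a).

End Hyperbolic.

(* Main.v *)
Require Import Defs.
From HB Require Import structures.
From mathcomp Require Import all_boot all_order all_algebra.
From mathcomp Require Import reals.
From mathcomp Require Import complex.
From mathcomp Require Import freeg mpoly.
From mathcomp Require Import ring zify.

(** Write [F] for the complexification of [f], [d = n + 1], and [a] for the
    entry [A_11]. The congruences of the construction say that modulo [F] the
    matrix [a A] is the product of a column and a row, with entries
    [conj A_1j] and [A_1k].

    Hence a [k]-rowed minor of [a A] is divisible by [F ^ (k-1)]
    ([det_rank1_mod]). The curves [F = 0] and [a = 0] have no common component,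
    so [a] can be cancelled and the minors of [A] itself are divisible
    ([minors_divisible]). Applied to the minors of order [d-1] this gives the
    matrix [M]; applied to [\det A], with a count of degrees, it gives
    [\det A = c F^(d-1)] for a constant [c], which is real because [A] is
    Hermitian. Then [\det (\adj A) = (\det A)^(d-1)] turns into
    [\det M = c^(d-1) F] ([adjugate_quotient]). The cancellation of [a] is the
    only arithmetic input: without a common factor, [F] divides [m] as soon as
    it divides [a m]. It is deduced from Gauss's lemma, in the form: every pair
    of elements factors as [g a', g b'] with [a'] coprime to [b'], and this
    property passes from a domain to its polynomials
    ([poly_has_gcd_factorization]).

    For the second part, fix a nonzero complex vector [v] and put
    [h = \sum_k v_k A_1k], which is nonzero because the first row is free, and
    [g = v^* A v]. The congruences combine into [conj h * h = a g] modulo [F].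
    Restrict everything to a real line [t e + b]. If [f] and [a] have no common
    zero there, interlacing is strict, so at the zeros [alpha_i] of [f] the
    values of [a] have the alternating signs of the denominators of Lagrange's
    formula. That formula, applied to [g], whose degree is [d-1], expresses
    [a(e) g(e)] as a sum of the numbers [|h(alpha_i)|^2] with positive weights
    ([interlacing_square_coef]). The sum is positive unless [h] vanishes at [d]
    points of the line, hence on all of it. A suitable real line exists:
    eliminating [t] between the restrictions of [F] and [a] to a generic line
    leaves a nonzero polynomial [r] in the base point [b] ([line_bezout]), and
    some real [b] satisfies [r(b) h(b) != 0]. Therefore [a(e) A(e)] is positive
    definite; so [c != 0], and [M(e)], a real multiple of the adjugate of
    [A(e)], is definite ([definite_adj]). *)

Set Implicit Arguments.
Unset Strict Implicit.
Unset Printing Implicit Defensive.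

Import Order.TTheory GRing.Theory Num.Theory.

Local Open Scope ring_scope.

(** * Divisibility and Gauss's lemma *)

Definition divides (R : comPzRingType) (a b : R) : Prop := exists r, b = r * a.

(** Coprimality in the only form in which it is used: [b] is cancellable modulo
    [a]. For two polynomials without common factor this is where unique
    factorization enters. *)
Definition nonzerodiv_mod (R : comPzRingType) (a b : R) : Prop :=
  forall c, divides a (b * c) -> divides a c.

Section Divisibility.
Variable R : idomainType.
Implicit Types a b c h : R.
Implicit Types p q : {poly R}.

Lemma divides_refl (S : comPzRingType) (a : S) : divides a a.
Proof. by exists 1; rewrite mul1r. Qed.

Lemma divides0 (S : comPzRingType) (a : S) : divides a 0.
Proof. by exists 0; rewrite mul0r. Qed.

Lemma divides_mull (S : comPzRingType) (a b c : S) :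
  divides a b -> divides a (c * b).
Proof. by case=> r ->; exists (c * r); rewrite mulrA. Qed.

Lemma divides_mulr (S : comPzRingType) (a b c : S) :
  divides a b -> divides a (b * c).
Proof. by rewrite mulrC; apply: divides_mull. Qed.

Lemma divides_add (S : comPzRingType) (a b c : S) :
  divides a b -> divides a c -> divides a (b + c).
Proof. by move=> [r ->] [s ->]; exists (r + s); rewrite mulrDl. Qed.

Lemma divides_sub (S : comPzRingType) (a b c : S) :
  divides a b -> divides a c -> divides a (b - c).
Proof. by move=> [r ->] [s ->]; exists (r - s); rewrite mulrBl. Qed.

Lemma divides_sum (S : comPzRingType) (I : Type) (r : seq I) (P : pred I)
    (F : I -> S) (a : S) :
  (forall i, P i -> divides a (F i)) -> divides a (\sum_(i <- r | P i) F i).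
Proof.
move=> dF; apply: (big_ind (divides a)) => //; first exact: divides0.
by move=> x y; apply: divides_add.
Qed.

Lemma divides_trans (S : comPzRingType) (a b c : S) :
  divides a b -> divides b c -> divides a c.
Proof. by move=> [r ->] [s ->]; exists (s * r); rewrite mulrA. Qed.

Lemma divides_cancel (S : idomainType) (a b c : S) :
  c != 0 -> divides (c * a) (c * b) -> divides a b.
Proof.
move=> c0 [r]; rewrite mulrCA => /(mulfI c0) ->.
exact/divides_mull/divides_refl.
Qed.

Lemma divides_polyC c p : divides c%:P p <-> forall i, divides c p`_i.
Proof.
split=> [[q ->] i|]; first by exists q`_i; rewrite coefMC.
elim/poly_ind: p => [|p a IHp] dc; first exact: divides0.
have [r ar] := dc 0%N; rewrite coefD coefMX add0r coefC eqxx in ar.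
have [|q ->] := IHp.
  by move=> i; have := dc i.+1; rewrite coefD coefMX coefC addr0.
by exists (q * 'X + r%:P); rewrite ar polyCM; ring.
Qed.

Lemma poly_split_low p : p != 0 ->
  exists p1 a, p = p1 * 'X + a%:P /\ (size p1 < size p)%N.
Proof.
elim/poly_ind: p => [|p1 a _]; first by rewrite eqxx.
move=> pn0; exists p1, a; split=> //; rewrite size_MXaddC.
case: ifP => // /andP[/eqP p10 /eqP a0].
by rewrite p10 a0 mul0r addr0 eqxx in pn0.
Qed.

(** A stand-in for unique factorization that needs no factorization into
    irreducibles and is inherited by polynomial rings. *)
Definition has_gcd_factorization : Prop := forall a b,
  exists g a' b', [/\ a = g * a', b = g * b' & nonzerodiv_mod a' b'].

(** Primitivity is stated as the conclusion of Gauss's lemma, so that products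
    and divisors by primitive polynomials need no further argument; the price is
    that [primitive_part] has to produce such polynomials. *)
Definition primitive p := forall c q, divides c%:P (p * q) -> divides c%:P q.

Section Gauss.
Hypothesis gcdR : has_gcd_factorization.

Lemma gcd_exists a b : exists g, [/\ divides g a, divides g b &
  forall h, divides h a -> divides h b -> divides h g].
Proof.
have [->|a0] := eqVneq a 0.
  by exists b; split=> //; [exact: divides0|exact: divides_refl].
have [g [a' [b' [Ea Eb nz]]]] := gcdR a b.
have a'0 : a' != 0 by apply: contraNneq a0 => a'0; rewrite Ea a'0 mulr0.
exists g; split; rewrite ?Ea ?Eb; try exact/divides_mulr/divides_refl.
move=> h [x Ex] [y Ey].
have [h0|h0] := eqVneq h 0.
  by rewrite h0 mulr0 in Ex; rewrite Ea Ex eqxx in a0.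
have /nz [k xk] : divides a' (b' * x).
  have E : b' * (x * h) = y * h * a' by rewrite -Ex -Ey; ring.
  by exists y; apply: (mulIf h0); rewrite -[LHS]mulrA E; ring.
exists k; apply: (mulfI a'0); rewrite mulrC Ex xk; ring.
Qed.

(** The content of [p], built coefficient by coefficient from gcds in [R]. *)
Lemma content_exists p : exists g, divides g%:P p /\
  forall h, divides h%:P p -> divides h g.
Proof.
elim/poly_ind: p => [|p a [g [gp gmax]]].
  by exists 0; split=> [|h _]; exact: divides0.
have [k [kg ka kmax]] := gcd_exists g a.
exists k; split=> [|h /divides_polyC dh].
  apply: divides_add; last by case: ka => r ->; exists r%:P; rewrite polyCM.
  apply/divides_mulr/(divides_trans _ gp).
  by case: kg => r ->; exists r%:P; rewrite polyCM.
apply: kmax; last by have := dh 0%N; rewrite coefD coefMX add0r coefC eqxx.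
apply/gmax/divides_polyC => i.
by have := dh i.+1; rewrite coefD coefMX coefC addr0.
Qed.

(** Gauss's lemma without primes. Compare constant coefficients: with
    [c = g c'], where [g] is the gcd of [c] with the constant coefficient of
    [p], the cofactor [c'] divides the constant coefficient of [q], and then, by
    induction on [q], all of [q]. After division by [c'] the claim concerns [g],
    which divides the constant coefficient of [p], so [p] can be shortened too.
    Allowing [c] to enter the coprimality condition on the coefficients of [p]
    is what lets the induction go through, as the truncation of a primitive [p]
    is in general not primitive. *)
Lemma gauss_content_coprime n c p q : (size p + size q <= n)%N ->
  (forall h, divides h c -> divides h%:P p -> h \is a GRing.unit) ->
  divides c%:P (p * q) -> divides c%:P q.
Proof.
elim: n c p q => [|n IHn] c p q sz cop cpq.
  move: sz; rewrite leqn0 addn_eq0 => /andP[_]; rewrite size_poly_eq0.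
  by move/eqP ->; exact: divides0.
have [->|q0] := eqVneq q 0; first exact: divides0.
have [p0|p0] := eqVneq p 0.
  exists (q * (c^-1)%:P); rewrite -mulrA -polyCM mulVr ?mulr1 //.
  by apply: cop; [exact: divides_refl | rewrite p0; exact: divides0].
have [c0|c0] := eqVneq c 0.
  have [r] := cpq; rewrite c0 mulr0 => /eqP.
  by rewrite mulf_eq0 (negPf p0) (negPf q0).
have [p1 [a [Ep szp]]] := poly_split_low p0.
have [q1 [b [Eq szq]]] := poly_split_low q0.
have [g [c' [a' [Ec Ea nz]]]] := gcdR c a.
have g0 : g != 0 by apply: contraNneq c0 => g0; rewrite Ec g0 mul0r.
have c'0 : c' != 0 by apply: contraNneq c0 => g'0; rewrite Ec g'0 mulr0.
have gP0 : g%:P != 0 by rewrite polyC_eq0.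
have c'P0 : c'%:P != 0 by rewrite polyC_eq0.
have [b' Eb] : divides c' b.
  apply/nz/(divides_cancel g0); rewrite -Ec mulrA -Ea.
  have /divides_polyC /(_ 0%N) := cpq.
  by rewrite Ep Eq coef0M !coefD !coefMX !coefC /= !add0r.
have EcP : c%:P = g%:P * c'%:P by rewrite Ec polyCM.
have [q1' Eq1] : divides c'%:P q1.
  apply: (divides_cancel gP0); rewrite -EcP.
  apply: (IHn c p) => //.
    rewrite mul_polyC -ltnS; apply: leq_trans sz.
    by rewrite ltn_add2l; apply: leq_ltn_trans szq; exact: size_scale_leq.
  have: divides c%:P (p * (g%:P * q1) * 'X).
    have -> : p * (g%:P * q1) * 'X = g%:P * (p * q) - p * b'%:P * c%:P.
      rewrite Eq Eb Ec !polyCM; ring.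
    by apply: divides_sub; [exact: divides_mull | exists (p * b'%:P)].
  move/divides_polyC => dX; apply/divides_polyC => i.
  by have := dX i.+1; rewrite coefMX.
pose q' := q1' * 'X + b'%:P.
have Eq' : q = c'%:P * q' by rewrite Eq Eq1 Eb /q' polyCM; ring.
have szq' : size q' = size q by rewrite Eq' mul_polyC size_scale.
(* [c'] has been split off [q]; the same comparison is repeated for [g] and [q'] *)
have gpq' : divides g%:P (p * q').
  by apply: (divides_cancel c'P0); rewrite mulrCA -Eq' mulrC -EcP.
have gp1q' : divides g%:P (p1 * q').
  have: divides g%:P (p1 * q' * 'X).
    have -> : p1 * q' * 'X = p * q' - q' * a'%:P * g%:P.
      by rewrite Ep Ea polyCM; ring.
    by apply: divides_sub => //; exists (q' * a'%:P).
  move/divides_polyC => dX; apply/divides_polyC => i.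
  by have := dX i.+1; rewrite coefMX.
have [r Er] : divides g%:P q'.
  apply: (IHn g p1) => //.
    by rewrite szq' -ltnS; apply: leq_trans sz; rewrite ltn_add2r.
  move=> h hg hp1; apply: cop.
    by rewrite Ec; apply: divides_mulr.
  rewrite Ep; apply: divides_add; first exact: divides_mulr.
  rewrite Ea; apply: divides_trans (_ : divides g%:P _).
    by case: hg => s ->; exists s%:P; rewrite polyCM.
  by exists a'%:P; rewrite -polyCM mulrC.
by exists r; rewrite Eq' Er EcP; ring.
Qed.

Lemma primitive_part p : p != 0 ->
  exists c p0, [/\ c != 0, p = c%:P * p0 & primitive p0].
Proof.
move=> pn0; have [c [[p0 Ep] cmax]] := content_exists p.
have c0 : c != 0 by apply: contraNneq pn0 => c0; rewrite Ep c0 mulr0.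
exists c, p0; split=> //; first by rewrite mulrC.
move=> k q kp; apply: gauss_content_coprime (leqnn _) _ kp => h _ [r Er].
have [|s /esym] := cmax (h * c).
  by exists r; rewrite Ep Er polyCM mulrA.
rewrite mulrA -[RHS]mul1r => /(mulIf c0) sh1.
by apply/unitrP; exists s; rewrite sh1 mulrC sh1.
Qed.

(** Divisibility by a primitive polynomial may be tested up to a constant, that
    is, over the fraction field. *)
Lemma primitive_divides k p q u : primitive q -> k != 0 ->
  k%:P * p = u * q -> divides q p.
Proof.
move=> prq k0 Ekp; have [|u' Eu] := prq k u.
  by exists p; rewrite mulrC -Ekp mulrC.
exists u'; apply: (mulfI (_ : k%:P != 0)); first by rewrite polyC_eq0.
by rewrite Ekp Eu; ring.
Qed.

Lemma gcdp_scaled_dvdl p q : exists k u, k != 0 /\ k%:P * p = u * gcdp p q.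
Proof.
have /Pdiv.Idomain.dvdpP[[k u] /= k0 E] := dvdp_gcdl p q.
by exists k, u; rewrite mul_polyC E.
Qed.

End Gauss.

End Divisibility.

Arguments has_gcd_factorization : clear implicits.

(** Pseudo-division in [R[X]] yields a gcd up to constants; its primitive part
    [H] is an honest common divisor. The cofactors of [H] satisfy a Bezout
    identity with a nonzero constant right-hand side, which makes their
    primitive parts coprime, while the contents are treated in [R]. *)
Lemma poly_has_gcd_factorization (R : idomainType) :
  has_gcd_factorization R -> has_gcd_factorization {poly R}.
Proof.
move=> gcdR F G.
have [->|F0] := eqVneq F 0.
  exists G, 0, 1; split; rewrite ?mulr0 ?mulr1 // => c.
  by rewrite mul1r.
have [->|G0] := eqVneq G 0.
  exists F, 1, 0; split; rewrite ?mulr0 ?mulr1 // => c _.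
  by exists c; rewrite mulr1.
have [|h [H [h0 EH prH]]] := primitive_part gcdR (p := gcdp F G).
  by rewrite gcdp_eq0 (negPf F0).
have [F1 EF] : divides H F.
  have [k [u [k0 E]]] := gcdp_scaled_dvdl F G.
  by apply: (primitive_divides prH k0 (u := u * h%:P)); rewrite E EH mulrA.
have [G1 EG] : divides H G.
  have /Pdiv.Idomain.dvdpP[[k u] /= k0 E] := dvdp_gcdr F G.
  apply: (primitive_divides prH k0 (u := u * h%:P)).
  by rewrite mul_polyC E EH mulrA.
have H0 : H != 0 by apply: contraNneq F0 => H0; rewrite EF H0 mulr0.
have F10 : F1 != 0 by apply: contraNneq F0 => F10; rewrite EF F10 mul0r.
have G10 : G1 != 0 by apply: contraNneq G0 => G10; rewrite EG G10 mul0r.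
have [r [u [v [r0 Er]]]] : exists r u v, r != 0 /\ u * F1 + v * G1 = r%:P.
  have [[u v] /= /eqpP [[s t] /andP[/= s0 t0] E]] := Bezoutp F G.
  exists (t * h), (s%:P * u), (s%:P * v); split; first by rewrite mulf_neq0.
  apply: (mulIf H0).
  rewrite mulrDl -!mulrA -EF -EG -mulrDr mul_polyC E EH -mul_polyC polyCM.
  by rewrite mulrA.
have [c [F2 [c0 EF1 prF]]] := primitive_part gcdR F10.
have [e [G2 [e0 EG1 prG]]] := primitive_part gcdR G10.
have [g [c' [e' [Ec Ee nz]]]] := gcdR c e.
exists (H * g%:P), (c'%:P * F2), (e'%:P * G2); split.
- by rewrite EF EF1 Ec polyCM; ring.
- by rewrite EG EG1 Ee polyCM; ring.
have F20 : F2 != 0 by apply: contraNneq F10 => F20; rewrite EF1 F20 mulr0.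
have e'0 : e' != 0 by apply: contraNneq e0 => e'0; rewrite Ee e'0 mulr0.
move=> m dm.
(* [r * e'] is a constant, and it can be removed because [F2] is primitive *)
have [m1 Em] : divides F2 m.
  have [w Ew] : divides F2 ((r * e')%:P * m).
    rewrite polyCM -Er EF1 EG1.
    have -> : (u * (c%:P * F2) + v * (e%:P * G2)) * e'%:P * m =
      (u * c%:P * e'%:P * m) * F2 + v * e%:P * (e'%:P * G2 * m) by ring.
    apply: divides_add; first exact/divides_mull/divides_refl.
    by apply/divides_mull/(divides_trans _ dm)/divides_mull/divides_refl.
  have [|w' Ew'] := prF (r * e') w.
    by exists m; rewrite mulrC -Ew mulrC.
  exists w'; apply: (mulfI (_ : (r * e')%:P != 0)).
    by rewrite polyC_eq0 mulf_neq0.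
  by rewrite Ew Ew'; ring.
suff [w Ew] : divides c'%:P m1.
  by exists w; rewrite Em Ew; ring.
have /divides_polyC dc : divides c'%:P (e'%:P * m1).
  apply: prG; apply: (divides_cancel F20).
  rewrite [F2 * _]mulrC; have -> : F2 * (G2 * (e'%:P * m1)) = e'%:P * G2 * m.
    by rewrite Em; ring.
  exact: dm.
by apply/divides_polyC => i; apply: nz; rewrite -coefCM.
Qed.

(** * Polynomials in several variables *)

(** Used throughout to identify two ways of substituting in a polynomial. *)
Lemma mpoly_rmorph_ext (K : comNzRingType) (n : nat) (S : comNzRingType)
    (phi psi : {rmorphism {mpoly K[n]} -> S}) :
  (forall c, phi c%:MP = psi c%:MP) -> (forall i, phi 'X_i = psi 'X_i) ->
  phi =1 psi.
Proof.
move=> eqC eqX p; rewrite [p]mpolyE !rmorph_sum; apply: eq_bigr => m _ /=.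
rewrite -mul_mpolyC !rmorphM /= eqC; congr (_ * _).
rewrite mpolyXE_id !rmorph_prod; apply: eq_bigr => i _.
by rewrite !rmorphXn /= eqX.
Qed.

Section Muni.
Variables (K : idomainType) (n : nat).

Lemma muni_widen (i : 'I_n) :
  muni ('X_(widen_ord (leqnSn n) i) : {mpoly K[n.+1]}) = ('X_i)%:P.
Proof.
rewrite muniE msuppX big_seq1 mcoeffX eqxx scale1r mnm1E.
rewrite -val_eqE /= (ltn_eqF (ltn_ord i)) expr0 alg_polyC; congr (_)%:P.
congr 'X_[_]; apply/mnmP => j; rewrite mnmE !mnm1E; congr (nat_of_bool _).
Qed.

Lemma muni_max : muni ('X_ord_max : {mpoly K[n.+1]}) = 'X.
Proof.
rewrite muniE msuppX big_seq1 mcoeffX eqxx scale1r mnm1E eqxx expr1.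
rewrite (_ : [multinom _ | i < n] = 0%MM) ?mpolyX0 ?scale1r //.
apply/mnmP => j; rewrite mnmE mnm1E mnm0E -val_eqE /=.
by rewrite gtn_eqF.
Qed.

Lemma ord_max_widen_ind (P : 'I_n.+1 -> Prop) :
  (forall i, P (widen_ord (leqnSn n) i)) -> P ord_max -> forall i, P i.
Proof.
move=> Pw Pm i; have [lt_in|] := ltnP i n.
  by have := Pw (Ordinal lt_in); congr P; apply: val_inj.
rewrite leq_eqVlt ltnNge -ltnS ltn_ord orbF => /eqP E.
by move: Pm; congr P; apply: val_inj.
Qed.

Definition unmuni : {poly {mpoly K[n]}} -> {mpoly K[n.+1]} :=
  horner_morph (fun p => mulrC 'X_ord_max (mwiden p)).

HB.instance Definition _ := GRing.RMorphism.copy unmuni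
  (horner_morph (fun p => mulrC 'X_ord_max (mwiden p))).

Lemma muniK : cancel (@muni n K) unmuni.
Proof.
apply: (mpoly_rmorph_ext (phi := unmuni \o @muni n K) (psi := idfun)) => /=.
  by move=> c; rewrite muniC /unmuni horner_morphC /= mwidenC.
apply: ord_max_widen_ind => [i|].
  rewrite muni_widen /unmuni horner_morphC /= mwidenX; congr 'X_[_].
  exact: mnmwiden1.
by rewrite muni_max /unmuni horner_morphX.
Qed.

Lemma muni_mwiden (p : {mpoly K[n]}) : muni (mwiden p) = p%:P.
Proof.
move: p; apply: (mpoly_rmorph_ext (phi := @muni n K \o @mwiden n K)
  (psi := polyC)) => /= [c|i]; first by rewrite mwidenC muniC.
by rewrite mwidenX mnmwiden1 muni_widen.
Qed.

Lemma unmuniK : cancel unmuni (@muni n K).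
Proof.
elim/poly_ind => [|p c IHp]; first by rewrite !rmorph0.
rewrite !rmorphD !rmorphM /= IHp /unmuni horner_morphC horner_morphX.
by rewrite muni_max muni_mwiden.
Qed.

Lemma meval_muni (v : 'I_n.+1 -> K) (p : {mpoly K[n.+1]}) :
  p.@[v] = (map_poly (meval (fun i => v (widen_ord (leqnSn n) i)))
    (muni p)).[v ord_max].
Proof.
move: p; apply: (mpoly_rmorph_ext (phi := meval v)
  (psi := horner_eval (v ord_max) \o
    (map_poly (meval (fun i => v (widen_ord (leqnSn n) i))) \o @muni n K))) => /=.
  by move=> c; rewrite muniC map_polyC /= /horner_eval hornerC !mevalC.
apply: ord_max_widen_ind => [i|]; rewrite mevalXU.
  by rewrite muni_widen map_polyC /= /horner_eval hornerC mevalXU.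
by rewrite muni_max map_polyX /horner_eval hornerX.
Qed.

End Muni.

Lemma has_gcd_factorization_iso (R S : idomainType) (f : {rmorphism S -> R})
    (g : R -> S) :
  cancel f g -> cancel g f -> has_gcd_factorization R -> has_gcd_factorization S.
Proof.
move=> fK gK gcdR a b; have [d [a' [b' [Ea Eb nz]]]] := gcdR (f a) (f b).
exists (g d), (g a'), (g b'); split.
- by apply: (can_inj fK); rewrite rmorphM /= !gK.
- by apply: (can_inj fK); rewrite rmorphM /= !gK.
move=> c [r Er]; have [|s Es] := nz (f c).
  by exists (f r); rewrite -(gK b') -(gK a') -!rmorphM /= Er.
by exists (g s); apply: (can_inj fK); rewrite rmorphM /= !gK.
Qed.

Lemma field_has_gcd_factorization (K : fieldType) : has_gcd_factorization K.
Proof.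
move=> a b; have [->|a0] := eqVneq a 0.
  exists b, 0, 1; split; rewrite ?mulr0 ?mulr1 // => c.
  by rewrite mul1r.
exists a, 1, (a^-1 * b); split; rewrite ?mulr1 ?mulVKf // => c _.
by exists c; rewrite mulr1.
Qed.

Lemma mpoly_has_gcd_factorization (K : fieldType) n :
  has_gcd_factorization {mpoly K[n]}.
Proof.
elim: n => [|n IHn].
  apply: (@has_gcd_factorization_iso K _ (mcoeff 0%MM) (@mpolyC 0 K)).
  - exact: mpolyKC.
  - exact: mpolyCK.
  - exact: field_has_gcd_factorization.
apply: (has_gcd_factorization_iso (@muniK K n) (@unmuniK K n)).
exact: poly_has_gcd_factorization.
Qed.

(** Points with natural coordinates suffice, and they are real: this is how real
    lines in general position are found for complex polynomials. *)
Lemma mpoly_nonvanishing (K : numFieldType) n (p : {mpoly K[n]}) :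
  p != 0 -> exists a : 'I_n -> nat, p.@[fun i => (a i)%:R] != 0.
Proof.
elim: n p => [|n IHn] p p0.
  exists (fun _ => 0%N); rewrite (nvar0_mpolyC p) mevalC.
  by apply: contraNneq p0 => p0; rewrite (nvar0_mpolyC p) p0 mpolyC0.
have q0 : muni p != 0.
  by apply: contraNneq p0 => q0; rewrite -(muniK p) q0 rmorph0.
have [|a lca] := IHn (lead_coef (muni p)); first by rewrite lead_coef_eq0.
pose v i : K := (a i)%:R.
have qv0 : map_poly (meval v) (muni p) != 0.
  apply: contraNneq lca => qv0; rewrite lead_coefE.
  have /polyP/(_ (size (muni p)).-1) := qv0.
  by rewrite coef_map coef0 => /= ->.
pose q := map_poly (meval v) (muni p).
have [t tq] : exists t : nat, ~~ root q t%:R.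
  pose rs := [seq (t%:R : K) | t <- iota 0 (size q)].
  have uq : uniq rs.
    by rewrite map_inj_uniq ?iota_uniq // => x y /eqP; rewrite eqr_nat => /eqP.
  have : ~~ all (root q) rs.
    by apply/negP => /(max_poly_roots qv0)/(_ uq); rewrite size_map size_iota ltnn.
  by move/allPn => [_ /mapP[t _ ->] tq]; exists t.
exists (fun i => if unlift ord_max i is Some j then a j else t).
rewrite meval_muni unlift_none; move: tq; congr (_.[_] != 0).
apply: eq_map_poly => c; apply: meval_eq => i.
rewrite (_ : widen_ord _ i = fintype.lift ord_max i) ?liftK //.
by apply: val_inj; rewrite /= /bump leqNgt ltn_ord.
Qed.

(** The common part [g] of [F] and [G] is a unit here. *)
Lemma no_common_factorP (R : realType) (F G : {mpoly R[i][3]}) :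
  no_common_factor F G -> nonzerodiv_mod F G.
Proof.
move=> ncf c.
have [g [F' [G' [EF EG nz]]]] := @mpoly_has_gcd_factorization R[i] 3 F G.
have ug : g \is a GRing.unit.
  by apply: ncf; [exists F' | exists G']; rewrite mulrC.
rewrite EF EG => dF.
have /nz [w ->] : divides F' (G' * c).
  apply: (divides_cancel (c := g)); first by apply: contraTneq ug => ->; rewrite unitr0.
  by rewrite mulrA.
by exists (w / g); rewrite -mulrA mulKr.
Qed.

(** Powers are needed because minors of order [k] involve [a ^ k] and
    [F ^ (k-1)]. *)
Lemma nonzerodiv_mod_exp (S : idomainType) (F a : S) k l :
  F != 0 -> nonzerodiv_mod F a -> nonzerodiv_mod (F ^+ k) (a ^+ l).
Proof.
move=> F0 nz.
have nzk : nonzerodiv_mod (F ^+ k) a.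
  elim: k => [|k IHk] c dk; first by exists c; rewrite mulr1.
  have [|c' Ec] := nz c.
    by apply: divides_trans dk; exists (F ^+ k); rewrite exprSr.
  have /IHk [w Ew] : divides (F ^+ k) (a * c').
    apply: (divides_cancel F0); rewrite -exprS.
    by rewrite Ec mulrA mulrC in dk.
  by exists w; rewrite Ec Ew exprSr mulrA.
elim: l => [|l IHl] c; first by rewrite mul1r.
by rewrite exprSr -mulrA => /IHl /nzk.
Qed.

(** * Restriction to a line *)

Section LineRestriction.
Variable n : nat.

Definition line_poly (S : comNzRingType) (e a : 'I_n -> S) (p : {mpoly S[n]}) :
    {poly S} :=
  mmap polyC (fun i => e i *: 'X + (a i)%:P) p.

HB.instance Definition _ (S : comNzRingType) (e a : 'I_n -> S) :=
  GRing.RMorphism.copy (line_poly e a)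
    (mmap polyC (fun i => e i *: 'X + (a i)%:P)).

Lemma line_polyC (S : comNzRingType) (e a : 'I_n -> S) c :
  line_poly e a c%:MP = c%:P.
Proof. by rewrite /line_poly mmapC. Qed.

Lemma line_polyX (S : comNzRingType) (e a : 'I_n -> S) i :
  line_poly e a 'X_i = e i *: 'X + (a i)%:P.
Proof. by rewrite /line_poly mmapX mmap1U. Qed.

Lemma line_poly_map (S T : comNzRingType) (phi : {rmorphism S -> T})
    (e a : 'I_n -> S) p :
  map_poly phi (line_poly e a p) =
  line_poly (phi \o e) (phi \o a) (map_mpoly phi p).
Proof.
move: p; apply: (mpoly_rmorph_ext (phi := map_poly phi \o line_poly e a)
  (psi := line_poly (phi \o e) (phi \o a) \o map_mpoly phi)) => /= [c|i].
  by rewrite line_polyC map_mpolyC line_polyC map_polyC.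
rewrite map_mpolyX !line_polyX rmorphD /= map_polyC.
by rewrite -!mul_polyC rmorphM /= map_polyC map_polyX.
Qed.

Lemma horner_line_poly (S : comNzRingType) (e a : 'I_n -> S) p t :
  (line_poly e a p).[t] = p.@[fun i => t * e i + a i].
Proof.
move: p; apply: (mpoly_rmorph_ext (phi := horner_eval t \o line_poly e a)
  (psi := meval (fun i => t * e i + a i))) => /= [c|i].
  by rewrite line_polyC /horner_eval hornerC mevalC.
by rewrite line_polyX /horner_eval mevalXU !hornerE mulrC.
Qed.

Section Generic.
Variables (K : idomainType) (e : 'I_n -> K).
Local Notation P := {mpoly K[n]}.

(** The restriction of a polynomial to the line with direction [s] through the
    generic point, whose coordinates are the variables themselves. *)
Definition generic_line (s : 'I_n -> K) : P -> {poly P} :=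
  mmap (polyC \o @mpolyC n K) (fun i => (s i)%:MP *: 'X + ('X_i)%:P).

HB.instance Definition _ s := GRing.RMorphism.copy (generic_line s)
  (mmap (polyC \o @mpolyC n K) (fun i => (s i)%:MP *: 'X + ('X_i)%:P)).

Lemma generic_lineC s c : generic_line s c%:MP = (c%:MP)%:P.
Proof. by rewrite /generic_line mmapC. Qed.

Lemma generic_lineX s i : generic_line s 'X_i = (s i)%:MP *: 'X + ('X_i)%:P.
Proof. by rewrite /generic_line mmapX mmap1U. Qed.

Lemma generic_line_eval s a p :
  map_poly (meval a) (generic_line s p) = line_poly s a p.
Proof.
move: p; apply: (mpoly_rmorph_ext
  (phi := map_poly (meval a) \o generic_line s) (psi := line_poly s a)).
  by move=> c /=; rewrite generic_lineC line_polyC map_polyC /= mevalC.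
move=> i /=; rewrite generic_lineX line_polyX rmorphD /= map_polyC /= mevalXU.
by rewrite -!mul_polyC rmorphM /= map_polyC map_polyX /= mevalC.
Qed.

Lemma generic_line_at0 s p : (generic_line s p).[0] = p.
Proof.
move: p; apply: (mpoly_rmorph_ext (phi := horner_eval 0 \o generic_line s)
  (psi := idfun)) => /= [c|i]; rewrite /horner_eval.
  by rewrite generic_lineC hornerC.
by rewrite generic_lineX !hornerE.
Qed.

(** Translation by [t s], as an endomorphism of [K[x][t]]. *)
Definition shift (s : 'I_n -> K) : {poly P} -> {poly P} :=
  horner_morph (fun p => mulrC 'X (generic_line s p)).

HB.instance Definition _ s := GRing.RMorphism.copy (shift s)
  (horner_morph (fun p => mulrC 'X (generic_line s p))).

Lemma shiftC s p : shift s p%:P = generic_line s p.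
Proof. by rewrite /shift horner_morphC. Qed.

Lemma shiftX s : shift s 'X = 'X.
Proof. by rewrite /shift horner_morphX. Qed.

Lemma shiftK s t : (forall i, s i + t i = 0) -> cancel (shift s) (shift t).
Proof.
move=> st0.
have stl p : shift t (generic_line s p) = p%:P.
  move: p; apply: (mpoly_rmorph_ext (phi := shift t \o generic_line s)
    (psi := polyC)) => /= [c|i].
    by rewrite generic_lineC shiftC generic_lineC.
  rewrite generic_lineX rmorphD -mul_polyC rmorphM /= !shiftC.
  rewrite shiftX generic_lineC generic_lineX addrA mul_polyC.
  by rewrite -scalerDl -mpolyCD st0 mpolyC0 scale0r add0r.
elim/poly_ind => [|p c IHp]; first by rewrite !rmorph0.
by rewrite !rmorphD !rmorphM /= !shiftX !shiftC IHp stl.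
Qed.

(** The morphisms are hidden behind an existential: all that matters is that
    [generic_line s] is the restriction to constants of an automorphism, so that
    it preserves coprimality. *)
Lemma translation_automorphism s :
  exists f g : {rmorphism {poly P} -> {poly P}},
    [/\ cancel f g, cancel g f & forall p, f p%:P = generic_line s p].
Proof.
exists (shift s), (shift (fun i => - s i)); split; last exact: shiftC.
  by apply: shiftK => i; rewrite subrr.
by apply: shiftK => i; rewrite addNr.
Qed.

(** If the gcd of the two restrictions had positive degree in [t], the first
    restriction [Ft] would divide a constant multiple of its cofactor [U], by
    coprimality of the restrictions; but [U] has smaller degree than [Ft]. *)
Lemma generic_bezout (F G : P) : nonzerodiv_mod F G -> F != 0 ->
  exists r U V, r != 0 /\ U * generic_line e F + V * generic_line e G = r%:P.
Proof.
move=> nz F0; have [f [g [fK gK fC]]] := translation_automorphism e.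
have Ft0 : generic_line e F != 0.
  by apply: contraNneq F0 => Ft0; rewrite -[F](generic_line_at0 e) Ft0 horner0.
have nzt : nonzerodiv_mod (generic_line e F) (generic_line e G).
  rewrite -!fC => q [w Ew].
  have [u Eu] : divides F%:P (g q).
    apply/divides_polyC => i; apply: nz; rewrite -coefCM; move: i.
    apply/divides_polyC; exists (g w).
    by rewrite -{1}(fK G%:P) -{1}(fK F%:P) -!rmorphM /= Ew.
  by exists (f u); rewrite -(gK q) Eu rmorphM.
move: (generic_line e F) (generic_line e G) Ft0 nzt => Ft Gt Ft0 nzt.
have [k [U [k0 EF]]] := gcdp_scaled_dvdl Ft Gt.
have /Pdiv.Idomain.dvdpP[[l V] /= l0 EG] := dvdp_gcdr Ft Gt.
have U0 : U != 0.
  apply: contraNneq Ft0 => U0; move/eqP: EF; rewrite U0 mul0r mulf_eq0.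
  by rewrite polyC_eq0 (negPf k0).
have lU0 : l%:P * U != 0 by rewrite mulf_neq0 // polyC_eq0.
(* with [k Ft = U H] and [l Gt = V H], the product [Gt * (l U)] is [k V Ft] *)
have [|w Ew] := nzt (l%:P * U).
  exists (k%:P * V); rewrite -mul_polyC in EG.
  have -> : Gt * (l%:P * U) = U * (l%:P * Gt) by ring.
  have -> : k%:P * V * Ft = V * (k%:P * Ft) by ring.
  by rewrite EG EF; ring.
have H0 : gcdp Ft Gt != 0 by rewrite gcdp_eq0 (negPf Ft0).
have szH : size (gcdp Ft Gt) = 1%N.
  have w0 : w != 0 by apply: contraNneq lU0 => w0; rewrite Ew w0 mul0r.
  have sF : size Ft = (size U + size (gcdp Ft Gt)).-1.
    by rewrite -size_mul // -EF mul_polyC size_scale.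
  have sU : size U = (size w + size Ft).-1.
    by rewrite -size_mul // -Ew mul_polyC size_scale.
  have := size_poly_gt0 w; have := size_poly_gt0 (gcdp Ft Gt).
  rewrite w0 H0; move: sF sU; set a := size _; set b := size _.
  by set c := size _; set k1 := size _; lia.
have [[A B] /= /eqpP [[s t] /andP[/= s0 t0] E]] := Bezoutp Ft Gt.
have /size_poly1P[h h0 EH] : size (gcdp Ft Gt) == 1%N by rewrite szH.
exists (t * h), (s%:P * A), (s%:P * B); rewrite mulf_neq0 //; split=> //.
by rewrite -!mulrA -mulrDr mul_polyC E EH -mul_polyC polyCM.
Qed.
(** At a point [a] with [r.@[a] != 0] the restrictions of [F] and [G] to the line
    through [a] with direction [e] have no common zero. *)
Lemma line_bezout (F G : P) : nonzerodiv_mod F G -> F != 0 ->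
  exists2 r : P, r != 0 & forall a, exists u v,
    u * line_poly e a F + v * line_poly e a G = (r.@[a])%:P.
Proof.
move=> nz F0; have [r [U [V [r0 Er]]]] := generic_bezout nz F0.
exists r => // a; exists (map_poly (meval a) U), (map_poly (meval a) V).
rewrite -(generic_line_eval e a F) -(generic_line_eval e a G).
by rewrite -!rmorphM -rmorphD Er /= map_polyC.
Qed.

End Generic.
End LineRestriction.

(** * Minors of a matrix of rank one modulo F *)

Lemma divides_prod (S : comPzRingType) (I : finType) (P : pred I)
    (F : S) (x : I -> S) :
  (forall i, P i -> divides F (x i)) ->
  divides (F ^+ #|P|) (\prod_(i | P i) x i).
Proof.
move=> dx; rewrite -prodr_const.
apply: (big_ind2 (fun a b : S => divides a b)) => //; first exact: divides_refl.
by move=> a b c d [r ->] [s ->]; exists (r * s); rewrite mulrACA.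
Qed.

(** In each term of the Leibniz formula only one factor comes from row [i0]. *)
Lemma det_all_but_row (S : comPzRingType) k (F : S) (N : 'M[S]_k) i0 :
  (forall i j, i != i0 -> divides F (N i j)) -> divides (F ^+ k.-1) (\det N).
Proof.
move=> dN; apply: divides_sum => s _; apply: divides_mull.
rewrite (bigD1 i0) //=; apply: divides_mull.
have -> : k.-1 = #|[pred i | i != i0]| by rewrite cardC1 card_ord.
by apply: divides_prod => i /dN.
Qed.

(** Bordering the matrix by [1], [- v] and [u] does not change the determinant
    and removes the term of rank one; what remains is divisible by [F] except in
    the first row and column. *)
Lemma det_rank1_mod (S : comNzRingType) k (F : S) (u : 'cV[S]_k) (v : 'rV_k)
    (Q : 'M_k) : divides (F ^+ k.-1) (\det (u *m v + F *: Q)).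
Proof.
pose N := block_mx (1%:M : 'M_1) (- v) u (F *: Q).
pose L := block_mx (1%:M : 'M_1) 0 (- u) (1%:M : 'M_k).
have LN : L *m N = block_mx (1%:M : 'M_1) (- v) 0 (u *m v + F *: Q).
  rewrite mulmx_block !mul1mx !mul0mx !addr0 mulmx1 mulNmx mulmxN.
  by rewrite opprK addNr.
have -> : \det (u *m v + F *: Q) = \det N.
  have := congr1 determinant LN.
  by rewrite det_mulmx det_lblock det_ublock !det1 !mul1r.
case: k u v Q @N @L {LN} => [|k] u v Q N _; first by exists (\det N); rewrite mulr1.
(* the minors of the first column have at most one row not divisible by [F],
   namely the one coming from the border *)
rewrite (expand_det_col N ord0); apply: divides_sum => i _.
apply/divides_mull/divides_mull/(det_all_but_row (i0 := ord0)) => i' j' i'0.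
rewrite 2!mxE.
have [x ->] : exists x : 'I_k.+1, fintype.lift i i' = rshift 1 x.
  have [y Ey|y Ey] := split_ordP (fintype.lift i i'); last by exists y.
  have := congr1 val Ey; rewrite ord1 /= /bump => /eqP.
  by rewrite addn_eq0 => /andP[_ i'z]; rewrite -val_eqE /= i'z in i'0.
have -> : fintype.lift ord0 j' = rshift 1 j' by apply: val_inj.
by rewrite block_mxEdr mxE; apply/divides_mulr/divides_refl.
Qed.

(** The matrix [a B] has rank one modulo [F], and [a] is cancellable. *)
Lemma minors_divisible (S : idomainType) k (F a : S) (B : 'M[S]_k)
    (u : 'I_k -> S) (v : 'I_k -> S) : F != 0 -> nonzerodiv_mod F a ->
  (forall i j, divides F (u i * v j - a * B i j)) ->
  divides (F ^+ k.-1) (\det B).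
Proof.
move=> F0 nz dB; apply: (nonzerodiv_mod_exp (k := k.-1) (l := k) F0 nz).
have /fin_all_exists [q Eq] i := fin_all_exists (dB i).
rewrite -detZ.
have -> : a *: B =
    (\col_i u i) *m (\row_j v j) + F *: (\matrix_(i, j) - q i j).
  apply/matrixP => i j; rewrite !mxE big_ord1 !mxE.
  by rewrite mulrN [F * _]mulrC -Eq opprB addrC subrK.
exact: det_rank1_mod.
Qed.

Section Homogeneous.
Variables (n : nat) (K : idomainType).
Implicit Types p q : {mpoly K[n]}.

(** Otherwise the product of [p] with the part of [q] outside degree [e] would
    be a form of degree [d + e] whose leading monomial has another degree. *)
Lemma dhomog_quotient d e p q :
  p != 0 -> p \is d.-homog -> q * p \is (d + e).-homog -> q \is e.-homog.
Proof.
move=> p0 homp homqp; have homq := pihomogP mdeg e q.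
suff /eqP : q - pihomog mdeg e q = 0 by rewrite subr_eq0 => /eqP ->.
apply/eqP; apply/negP => /negP q'0.
have hom' : (q - pihomog mdeg e q) * p \is (d + e).-homog.
  by rewrite mulrBl rpredB // addnC; apply: dhomogM.
have q'p0 : (q - pihomog mdeg e q) * p != 0 by rewrite mulf_neq0.
have deg' : mdeg (mlead (q - pihomog mdeg e q)) = e.
  have degM : mdeg (mlead ((q - pihomog mdeg e q) * p)) = (d + e)%N.
    exact: dhomog_mf hom' _ (mlead_supp q'p0).
  have degp : mdeg (mlead p) = d := dhomog_mf homp (mlead_supp p0).
  by move: degM; rewrite mleadM // mdegD degp addnC => /addnI.
set m := mlead _ in deg'.
suff E : (pihomog mdeg e q)@_m = q@_m.
  by have := mlead_supp q'0; rewrite mcoeff_msupp mcoeffB E subrr eqxx.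
rewrite pihomogE [in RHS](mpolyE q) !raddf_sum /=.
rewrite [in RHS](bigID (fun i => mdeg i == e)) /=.
rewrite [X in _ = _ + X]big1 ?addr0 // => i ie; rewrite mcoeffZ mcoeffX.
by case: eqP => [im|_]; [rewrite im deg' eqxx in ie | rewrite mulr0].
Qed.

Lemma dhomog_prod_const k (F : 'I_k -> {mpoly K[n]}) d :
  (forall i, F i \is d.-homog) -> \prod_i F i \is (k * d).-homog.
Proof.
elim: k F => [|k IHk] F homF; first by rewrite big_ord0 mul0n dhomog1.
by rewrite big_ord_recl mulSn; apply: dhomogM => //; apply: IHk.
Qed.

Lemma dhomog_det k (B : 'M[{mpoly K[n]}]_k) d :
  (forall i j, B i j \is d.-homog) -> \det B \is (k * d).-homog.
Proof.
move=> homB; apply: rpred_sum => s _.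
rewrite -signr_odd mulr_sign; case: (odd _); last exact: dhomog_prod_const.
by rewrite rpredN; apply: dhomog_prod_const.
Qed.

Lemma dhomog_adj k (B : 'M[{mpoly K[n]}]_k) d i j :
  (forall i j, B i j \is d.-homog) -> (\adj B) i j \is (k.-1 * d).-homog.
Proof.
move=> homB; rewrite mxE /cofactor -signr_odd mulr_sign.
have H : \det (row' j (col' i B)) \is (k.-1 * d).-homog.
  by apply: dhomog_det => x y; rewrite !mxE.
by case: (odd _); rewrite ?rpredN.
Qed.

Lemma dhomog0_const p : p \is 0.-homog -> p = (p@_0)%:MP.
Proof.
move=> homp; apply: msize1_polyC; rewrite msizeE; apply/bigmax_leqP_seq.
by move=> m mp _; rewrite (dhomog_mf homp mp).
Qed.

End Homogeneous.

(** For a singular [B] cancellation is impossible; but then an invertible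
    determinant of [\adj B] would force [B = 0]. *)
Lemma det_adj (S : idomainType) k (B : 'M[S]_k.+1) :
  \det (\adj B) = \det B ^+ k.
Proof.
have [dB0|dB0] := eqVneq (\det B) 0; last first.
  apply: (mulfI dB0); rewrite -det_mulmx mul_mx_adj det_scalar -exprS //.
case: k B dB0 => [|k] B dB0.
  rewrite expr0 [X in \det X]mx11_scalar det_scalar1 mxE /cofactor det_mx00.
  by rewrite expr0 mulr1.
rewrite dB0 expr0n /=; apply/eqP; apply: contraTT isT => dA0.
have B0 : B = 0.
  have BA0 : B *m \adj B *m \adj (\adj B) = 0.
    by rewrite mul_mx_adj dB0 -scalemx1 scale0r mul0mx.
  rewrite -mulmxA mul_mx_adj mul_mx_scalar in BA0.
  apply/matrixP => i j; have /matrixP/(_ i j) := BA0; rewrite !mxE => /eqP.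
  by rewrite mulf_eq0 (negPf dA0) => /eqP.
suff A0 : \adj B = 0 by rewrite A0 det0 eqxx in dA0.
apply/matrixP => i j; rewrite !mxE /cofactor B0.
have -> : row' j (col' i (0 : 'M[S]_k.+2)) = 0 by apply/matrixP => x y; rewrite !mxE.
by rewrite det0 mulr0.
Qed.

(** The conclusions for [d = n + 1]; for [d = 1] the factor [1 / F^(d-2)] is [F],
    which is the role of the conditional. *)
Lemma adjugate_quotient (K : idomainType) m n (F a : {mpoly K[m]})
    (A : 'M[{mpoly K[m]}]_n.+1) (u v : 'I_n.+1 -> {mpoly K[m]}) :
  F != 0 -> F \is n.+1.-homog -> nonzerodiv_mod F a ->
  (forall j k, A j k \is n.-homog) ->
  (forall j k, divides F (u j * v k - a * A j k)) ->
  exists (M : 'M_n.+1) (c : K),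
    [/\ F ^+ n.-1 *: M = (if n == 0%N then F else 1) *: \adj A,
        forall j k, M j k \is 1.-homog,
        \det A = c%:MP * F ^+ n & \det M = (c ^+ n)%:MP * F].
Proof.
move=> F0 homF nz homA rank1.
have homadj j k : (\adj A) j k \is (n * n).-homog by apply: dhomog_adj.
have [c detA] : exists c, \det A = c%:MP * F ^+ n.
  have [w Ew] := minors_divisible F0 nz rank1.
  have homw : w \is 0.-homog.
    apply: (@dhomog_quotient _ _ (n.+1 * n) _ (F ^+ n)).
    - by rewrite expf_neq0.
    - exact: dhomogMn.
    - by rewrite addn0 -Ew; apply: dhomog_det.
  by exists w@_0; rewrite -dhomog0_const.
case: n F0 homF A u v homA rank1 homadj detA
  => [|n] F0 homF A u v homA rank1 homadj detA.
  exists (F *: \adj A), c; split=> //=; first by rewrite expr0 scale1r.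
    by move=> j k; rewrite mxE; exact: (dhomogM homF (homadj j k)).
  by rewrite detZ det_adj !expr1 mulr1 mul1r.
have adj_div j k : divides (F ^+ n) ((\adj A) j k).
  rewrite mxE /cofactor; apply: divides_mull.
  apply: (minors_divisible F0 nz (u := fun x => u (fintype.lift k x))
    (v := fun x => v (fintype.lift j x))) => x y; rewrite !mxE; exact: rank1.
have /fin_all_exists [M0 EM0] j := fin_all_exists (adj_div j).
pose M : 'M_n.+2 := \matrix_(j, k) M0 j k.
have EM : F ^+ n *: M = \adj A by apply/matrixP => j k; rewrite EM0 !mxE mulrC.
exists M, c; split=> //=; first by rewrite scale1r.
  move=> j k; apply: (@dhomog_quotient _ _ (n.+2 * n) _ (F ^+ n)).
  - by rewrite expf_neq0.
  - exact: dhomogMn.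
  - rewrite mxE -EM0; suff <- : (n.+1 * n.+1 = n.+2 * n + 1)%N by [].
    by rewrite !mulSn mulnS; lia.
have FN0 : F ^+ (n * n.+2) != 0 by rewrite expf_neq0.
apply: (mulfI FN0).
rewrite exprM -detZ EM det_adj detA exprMn -!exprM mulrCA -exprSr rmorphXn.
by congr (_ * _ ^+ _); lia.
Qed.

(** * Interlacing and Lagrange interpolation *)

(** Pair the factor [a i - b j] with [a i - a (lift i j)]: strict interlacing
    puts [b j] and [a (lift i j)] on the same side of [a i]. *)
Lemma interlacing_prod_gt0 (R : realFieldType) n (a b : nat -> R) :
  (forall i, (i < n)%N -> a i < b i < a i.+1) ->
  forall i : 'I_n.+1,
    0 < (\prod_(j < n) (a i - b j)) * \prod_(j < n) (a i - a (fintype.lift i j)).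
Proof.
move=> ab i.
have a_mono j k : (j < k <= n)%N -> a j < a k.
  elim: k => // k IHk /andP[jk kn]; have /andP[akb bak] := ab k kn.
  have akS : a k < a k.+1 by apply: lt_trans bak.
  move: jk; rewrite ltnS leq_eqVlt => /orP[/eqP -> //|jk].
  by apply: lt_trans akS; apply: IHk; rewrite jk ltnW.
have in_ := ltn_ord i; rewrite ltnS in in_.
rewrite -big_split /=; apply: prodr_gt0 => j _ /=.
have /andP[ajb baj] := ab j (ltn_ord j); rewrite /bump; case: leqP => ij.
  have aij : a i <= a j.
    move: ij; rewrite leq_eqVlt => /orP[/eqP -> //|ij].
    by apply/ltW/a_mono; rewrite ij ltnW.
  rewrite nmulr_lgt0 subr_lt0; first exact: le_lt_trans ajb.
  by apply: le_lt_trans aij _; apply: lt_trans baj.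
have aji : a j.+1 <= a i.
  move: ij; rewrite leq_eqVlt => /orP[/eqP -> //|ij].
  by apply/ltW/a_mono; rewrite ij.
have aji' : a j < a i by apply: lt_le_trans aji; apply: lt_trans baj.
by rewrite mulr_gt0 // subr_gt0 //; apply: lt_le_trans aji.
Qed.

(** The leading coefficient of Lagrange's interpolation formula. *)
Lemma lagrange_coef (F : fieldType) n (a : 'I_n.+1 -> F) (q : {poly F}) :
  injective a -> (size q <= n.+1)%N ->
  q`_n = \sum_i q.[a i] / \prod_(j < n) (a i - a (fintype.lift i j)).
Proof.
move=> inj_a szq.
pose D i := \prod_(j < n) (a i - a (fintype.lift i j)).
have D0 i : D i != 0.
  apply/prodf_neq0 => j _; rewrite subr_eq0 (inj_eq inj_a).
  exact: neq_lift.
pose N (i : 'I_n.+1) := \prod_(j < n) ('X - (a (fintype.lift i j))%:P).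
have szN i : size (N i) = n.+1.
  by rewrite size_prod_XsubC /index_enum -enumT size_enum_ord.
pose L := \sum_i (q.[a i] / D i) *: N i.
have coefL : L`_n = \sum_i q.[a i] / D i.
  rewrite coef_sum; apply: eq_bigr => i _.
  have /monicP : N i \is monic by exact: monic_prod_XsubC.
  by rewrite coefZ lead_coefE szN /= => ->; rewrite mulr1.
suff /eqP : q - L = 0 by rewrite subr_eq0 => /eqP qL; rewrite [in LHS]qL coefL.
have szqL : (size (q - L)%R <= n.+1)%N.
  rewrite (leq_trans (size_polyD _ _)) // geq_max szq size_polyN.
  apply: (leq_trans (size_sum _ _ _)); apply/bigmax_leqP => i _.
  by apply: leq_trans (size_scale_leq _ _) _; rewrite szN.
have rootqL i : root (q - L) (a i).
  rewrite /root hornerD hornerN horner_sum (bigD1 i) //= big1 => [|k ki].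
    rewrite addr0 hornerZ horner_prod (eq_bigr (fun j => a i - a (fintype.lift i j))).
      by rewrite -/(D i) divfK ?subrr.
    by move=> j _; rewrite hornerXsubC.
  have [j ij] := unlift_some ki.
  rewrite hornerZ horner_prod (bigD1 j) //= hornerXsubC -ij subrr mul0r.
  by rewrite mulr0.
apply/eqP; apply: contraTT szqL => qL0; rewrite -ltnNge.
rewrite -[n.+1]card_ord -(size_codom a); apply: max_poly_roots => //.
  by apply/allP => x /codomP[i ->].
exact/injectiveP.
Qed.

Section HermitianSquare.
Variable R : realType.
Local Notation C := R[i].
Local Notation rc := (real_complex R).

Lemma conj_real_complex x : Num.conj (rc x) = rc x.
Proof. by apply/conj_Creal/complex_realP; exists x. Qed.

Lemma horner_conj_real (h : {poly C}) x :
  (map_poly Num.conj h).[rc x] = Num.conj h.[rc x].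
Proof. by rewrite -{1}[rc x]conj_real_complex horner_map. Qed.

(** At a zero [x] of [p] the last hypothesis reads [|h(x)|^2 = q(x) g(x)]. Since
    the sign of [q(x)] is known from interlacing, Lagrange's formula for the
    coefficient of [g] becomes a sum of squares with positive weights; they do
    not all vanish, as [h] has fewer zeros than [p]. *)
Lemma interlacing_square_coef (p q : {poly R}) (h g w : {poly C}) n :
  interlaces_poly q p -> size p = n.+2 ->
  (forall x, root p x -> ~~ root q x) ->
  h != 0 -> (size h <= n.+1)%N -> (size g <= n.+1)%N ->
  map_poly Num.conj h * h = map_poly rc q * g + w * map_poly rc p ->
  0 < rc q`_n * g`_n.
Proof.
case=> alpha [beta [[p0 Ep] [q0 Eq] _ szab inter]] szp pq h0 szh szg Ehg.
have szb : size beta = n.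
  have : size p = (size alpha).+1.
    by rewrite Ep size_scale ?lead_coef_eq0 // size_prod_XsubC.
  by rewrite szp szab => -[].
have szq : size q = n.+1.
  by rewrite Eq size_scale ?lead_coef_eq0 // size_prod_XsubC szb.
have -> : q`_n = lead_coef q by rewrite lead_coefE szq.
pose a i := alpha`_i; pose b i := beta`_i.
have root_a (i : nat) : (i < n.+1)%N -> root p (a i).
  move=> i_n; rewrite Ep rootZ ?lead_coef_eq0 // root_prod_XsubC.
  by apply: mem_nth; rewrite szab szb.
have root_b (i : nat) : (i < n)%N -> root q (b i).
  move=> i_n; rewrite Eq rootZ ?lead_coef_eq0 // root_prod_XsubC.
  by apply: mem_nth; rewrite szb.
have ab i : (i < n)%N -> a i < b i < a i.+1.
  move=> i_n; have := inter i; rewrite szb => /(_ i_n) /andP[ab ba].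
  rewrite !lt_neqAle ab ba !andbT; apply/andP; split.
    by apply: contraL (root_b i i_n) => /eqP <-; apply/pq/root_a/ltnW.
  by apply: contraL (root_b i i_n) => /eqP ->; apply/pq/root_a.
pose B (i : 'I_n.+1) := \prod_(j < n) (a i - b j).
pose D (i : 'I_n.+1) := \prod_(j < n) (a i - a (fintype.lift i j)).
have BD i : 0 < B i * D i by exact: interlacing_prod_gt0.
have D0 i : D i != 0 by have := BD i; apply: contraTneq => ->; rewrite mulr0 ltxx.
have B0 i : B i != 0 by have := BD i; apply: contraTneq => ->; rewrite mul0r ltxx.
have qa (i : 'I_n.+1) : q.[a i] = lead_coef q * B i.
  rewrite {1}Eq hornerZ; congr (_ * _); rewrite horner_prod.
  rewrite (big_nth 0) szb big_mkord; apply: eq_bigr => j _.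
  by rewrite hornerXsubC.
have inj_a : injective (fun i : 'I_n.+1 => rc (a i)).
  move=> i j /complexI eqa; apply/eqP; apply: contraT => ij.
  have [k jk _] := unlift_some ij.
  by have /prodf_neq0/(_ k isT) := D0 i; rewrite -jk eqa subrr eqxx.
have lq0 : rc (lead_coef q) != 0 by rewrite fmorph_eq0 lead_coef_eq0.
pose sq (i : 'I_n.+1) := Num.conj h.[rc (a i)] * h.[rc (a i)].
have sq_ge0 i : 0 <= sq i by rewrite /sq mulrC mul_conjC_ge0.
have term (i : 'I_n.+1) : rc (lead_coef q) * (g.[rc (a i)] /
    \prod_(j < n) (rc (a i) - rc (a (fintype.lift i j)))) = sq i / rc (B i * D i).
  have -> : \prod_(j < n) (rc (a i) - rc (a (fintype.lift i j))) = rc (D i).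
    by rewrite rmorph_prod; apply: eq_bigr => j _; rewrite rmorphB.
  have /(congr1 (fun r : {poly C} => r.[rc (a i)])) := Ehg.
  rewrite hornerD !hornerM horner_conj_real !horner_map /= qa.
  have /eqP -> : root p (a i) by exact/root_a/ltn_ord.
  rewrite rmorph0 mulr0 addr0 -/(sq i) => ->.
  have Bi0 : rc (B i) != 0 by rewrite fmorph_eq0.
  have Di0 : rc (D i) != 0 by rewrite fmorph_eq0.
  by rewrite !rmorphM /=; field; rewrite Bi0 Di0.
rewrite (lagrange_coef inj_a szg) mulr_sumr (eq_bigr _ (fun i _ => term i)).
have term_ge0 i : 0 <= sq i / rc (B i * D i).
  by rewrite divr_ge0 // (lecR 0) ltW.
rewrite lt_def sumr_ge0 ?andbT //; apply/negP => /eqP sum0.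
suff: (n.+1 < size h)%N by rewrite ltnNge szh.
rewrite -[n.+1]card_ord -(size_codom (fun i : 'I_n.+1 => rc (a i))).
apply: max_poly_roots => //; last exact/injectiveP.
apply/allP => x /codomP[i ->].
have /eqP := psumr_eq0P (fun i _ => term_ge0 i) sum0 (i := i) isT.
rewrite mulf_eq0 invr_eq0 fmorph_eq0 (gt_eqF (BD i)) orbF mulf_eq0.
by rewrite conjC_eq0 orbb.
Qed.
End HermitianSquare.

(** * Degree of the restriction of a form to a line *)

Section TopCoefficient.
Variables (S : comNzRingType).

Lemma coef_top_mul (p q : {poly S}) k l :
  (size p <= k.+1)%N -> (size q <= l.+1)%N ->
  (size (p * q)%R <= (k + l).+1)%N /\ (p * q)`_(k + l) = p`_k * q`_l.
Proof.
move=> szp szq; split.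
  apply: leq_trans (size_polyMleq _ _) _.
  by rewrite -ltnS (leq_trans (leqSpred _)) //; move: szp szq; lia.
have k_lt : (k < (k + l).+1)%N by rewrite ltnS leq_addr.
rewrite coefM (bigD1 (Ordinal k_lt)) //= addKn big1 ?addr0 // => j jk.
have [jk'|kj] := ltnP j k.
  by rewrite [q`_ _]nth_default ?mulr0 // (leq_trans szq) //; move: jk'; lia.
rewrite nth_default ?mul0r // (leq_trans szp) // ltn_neqAle kj andbT.
by rewrite eq_sym -val_eqE in jk *.
Qed.

Lemma coef_top_prod I (r : seq I) (p : I -> {poly S}) (k : I -> nat) :
  (forall i, size (p i) <= (k i).+1)%N ->
  (size (\prod_(i <- r) p i)%R <= (\sum_(i <- r) k i).+1)%N /\
  (\prod_(i <- r) p i)`_(\sum_(i <- r) k i) = \prod_(i <- r) (p i)`_(k i).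
Proof.
move=> szp; elim: r => [|i r [IHs IHc]].
  by rewrite !big_nil size_poly1 coef1.
rewrite !big_cons; have [szm cm] := coef_top_mul (szp i) IHs.
by rewrite szm cm IHc.
Qed.

Lemma coef_top_exp (p : {poly S}) m :
  (size p <= 2)%N -> (size (p ^+ m)%R <= m.+1)%N /\ (p ^+ m)`_m = p`_1 ^+ m.
Proof.
move=> szp; have := coef_top_prod (index_enum 'I_m) (k := fun=> 1%N) (fun=> szp).
by rewrite !prodr_const sum_nat_const card_ord muln1.
Qed.

(** The top coefficient in [t] of [g (t e + a)] is the value of [g] at [e]: this
    is what links Lagrange's formula on a line with the matrix [A(e)]. *)
Lemma line_poly_top n (e a : 'I_n -> S) (g : {mpoly S[n]}) k :
  g \is k.-homog ->
  (size (line_poly e a g) <= k.+1)%N /\ (line_poly e a g)`_k = g.@[e].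
Proof.
move=> homg; pose l i : {poly S} := e i *: 'X + (a i)%:P.
have top m : m \in msupp g ->
    (size (mmap1 l m) <= k.+1)%N /\
    (mmap1 l m)`_k = \prod_i e i ^+ m i.
  move=> mg; have <- : mdeg m = k by exact: dhomog_mf homg _ mg.
  have szl i : (size (l i) <= 2)%N.
    rewrite (leq_trans (size_polyD _ _)) // geq_max.
    rewrite (leq_trans (size_scale_leq _ _)) ?size_polyX //=.
    by rewrite (leq_trans (size_polyC_leq1 _)).
  have := coef_top_prod (index_enum 'I_n) (k := m)
    (fun i => (coef_top_exp (m i) (szl i)).1).
  rewrite -mdegE => -[sz cf]; split=> //; rewrite /mmap1 cf.
  apply: eq_bigr => i _; rewrite (coef_top_exp _ (szl i)).2.
  by rewrite coefD coefZ coefX coefC /= mulr1 addr0.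
rewrite /line_poly /mmap mevalE; split.
  apply: (leq_trans (size_sum _ _ _)).
  apply/bigmax_leqP_seq => m mg _; rewrite mul_polyC.
  by apply: leq_trans (size_scale_leq _ _) (top m mg).1.
rewrite coef_sum !big_seq; apply: eq_bigr => m mg.
by rewrite coefCM (top m mg).2.
Qed.

End TopCoefficient.

(** * Definiteness of A(e) *)

HB.instance Definition _ (R : realType) := GRing.RMorphism.copy
  (@complexify R) (map_mpoly (real_complex R)).
HB.instance Definition _ (R : realType) := GRing.RMorphism.copy
  (@conj_mpoly R) (map_mpoly (Num.conj : R[i] -> R[i])).

Lemma map_mpoly_homog (K : fieldType) (S : nzRingType)
    (phi : {rmorphism K -> S}) n k (p : {mpoly K[n]}) :
  p \is k.-homog -> map_mpoly phi p \is k.-homog.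
Proof.
move=> /dhomogP homp; apply/dhomogP => m.
by rewrite (perm_mem (msupp_map_mpoly _ (fmorph_inj phi))); apply: homp.
Qed.

Section Definiteness.
Local Open Scope sesquilinear_scope.
Variable R : realType.
Local Notation C := R[i].
Local Notation rc := (real_complex R).

Lemma conj_mpolyC c : conj_mpoly (c%:MP : {mpoly C[3]}) = (Num.conj c)%:MP.
Proof. exact: map_mpolyC. Qed.

Lemma conj_mpolyX i : conj_mpoly ('X_i : {mpoly C[3]}) = 'X_i.
Proof. exact: map_mpolyX. Qed.

Lemma complexifyC c : complexify (c%:MP : {mpoly R[3]}) = (rc c)%:MP.
Proof. exact: map_mpolyC. Qed.

Lemma complexifyX i : complexify ('X_i : {mpoly R[3]}) = 'X_i.
Proof. exact: map_mpolyX. Qed.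

Lemma conj_complexify (p : {mpoly R[3]}) :
  conj_mpoly (complexify p) = complexify p.
Proof.
move: p; apply: (mpoly_rmorph_ext (phi := @conj_mpoly R \o @complexify R)
  (psi := @complexify R)) => /= [c|i].
  by rewrite complexifyC conj_mpolyC conj_real_complex.
by rewrite complexifyX conj_mpolyX.
Qed.

Lemma conj_mpolyK : involutive (@conj_mpoly R).
Proof.
apply: (mpoly_rmorph_ext (phi := @conj_mpoly R \o @conj_mpoly R)
  (psi := idfun)) => /= [c|i]; last by rewrite !conj_mpolyX.
by rewrite !conj_mpolyC conjCK.
Qed.

Lemma meval_complexify (p : {mpoly R[3]}) (e : 'I_3 -> R) :
  (complexify p).@[rc \o e] = rc p.@[e].
Proof.
move: p; apply: (mpoly_rmorph_ext (phi := meval (rc \o e) \o @complexify R)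
  (psi := rc \o meval e)) => /= [c|i].
  by rewrite complexifyC !mevalC.
by rewrite complexifyX !mevalXU.
Qed.

Lemma meval_conj (p : {mpoly C[3]}) (e : 'I_3 -> R) :
  (conj_mpoly p).@[rc \o e] = Num.conj p.@[rc \o e].
Proof.
move: p; apply: (mpoly_rmorph_ext (phi := meval (rc \o e) \o @conj_mpoly R)
  (psi := Num.conj \o meval (rc \o e))) => /= [c|i].
  by rewrite conj_mpolyC !mevalC.
by rewrite conj_mpolyX !mevalXU /= conj_real_complex.
Qed.

Lemma line_poly_conj (e a : 'I_3 -> R) (p : {mpoly C[3]}) :
  map_poly Num.conj (line_poly (rc \o e) (rc \o a) p) =
  line_poly (rc \o e) (rc \o a) (conj_mpoly p).
Proof.
rewrite line_poly_map; apply: eq_bigr => m _; congr (_ * _).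
by apply: mmap1_eq => i /=; rewrite !conj_real_complex.
Qed.

(** Real points are written [rc \o e], the form in which conjugation and
    evaluation visibly commute. *)
Lemma eval_mxE n (M : 'M[{mpoly C[3]}]_n) (e : 'rV[R]_3) j k :
  eval_mx M e j k = (M j k).@[rc \o e 0].
Proof. by rewrite mxE; apply: meval_eq => i; rewrite mxE. Qed.

Lemma eval_mx_herm n (M : 'M[{mpoly C[3]}]_n) (e : 'rV[R]_3) :
  (forall j k, M k j = conj_mpoly (M j k)) -> (eval_mx M e) ^t* = eval_mx M e.
Proof.
by move=> herm; apply/matrixP => j k; rewrite 2!mxE !eval_mxE (herm k j) meval_conj.
Qed.

Section RankOne.
Variables (n : nat) (f a11 : {mpoly R[3]}) (A : 'M[{mpoly C[3]}]_n.+1).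
Variable i0 : 'I_n.+1.
Hypothesis A11 : A i0 i0 = complexify a11.
Hypothesis homA : forall j k, A j k \is n.-homog.
Hypothesis rank1 : forall j k,
  divides (complexify f) (conj_mpoly (A i0 j) * A i0 k - A i0 i0 * A j k).
Hypothesis coprime : nonzerodiv_mod (complexify f) (A i0 i0).
Hypothesis free : forall c : 'I_n.+1 -> C,
  \sum_k c k *: A i0 k = 0 -> forall k, c k = 0.
Hypothesis f_homog : f \is n.+1.-homog.

(** With [h = \sum_k v_k A_1k] and [g = v^* A v], the value [g(e)] is the top
    coefficient of [g] on every line with direction [e]; a real line on which
    [f] and [a11] have no common zero and [h] does not vanish identically gives
    its sign. *)
Lemma interlacing_hermitian_gt0 (e : 'rV[R]_3) (v : 'cV[C]_n.+1) :
  f.@[e 0] != 0 -> interlaces n.+1 a11 f e -> v != 0 ->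
  0 < rc a11.@[e 0] * (v ^t* *m eval_mx A e *m v) 0 0.
Proof.
move=> fe0 [a11_hom inter] v0.
set F := complexify f; pose eC := rc \o e 0.
have F0 : F != 0.
  apply: contraNneq fe0 => F0; have := meval_complexify f (e 0).
  by rewrite -/F F0 meval0 => /esym/eqP; rewrite fmorph_eq0.
pose h := \sum_k v k 0 *: A i0 k.
pose g := \sum_j \sum_k (Num.conj (v j 0) * v k 0) *: A j k.
have h0 : h != 0.
  apply: contraNneq v0 => /free vk; apply/eqP/matrixP => k j.
  by rewrite ord1 mxE vk.
(* the combination of all rank one congruences with weights [conj v_j * v_k] *)
have [w Ew] : divides F (conj_mpoly h * h - A i0 i0 * g).
  rewrite /h /g rmorph_sum /= mulr_suml mulr_sumr -sumrB; apply: divides_sum => j _.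
  rewrite mulr_sumr mulr_sumr -sumrB; apply: divides_sum => k _.
  have -> : conj_mpoly (v j 0 *: A i0 j) = Num.conj (v j 0) *: conj_mpoly (A i0 j).
    by rewrite /conj_mpoly map_mpolyZ.
  rewrite -!scalerAl -!scalerAr scalerA -scalerBr -mul_mpolyC.
  exact/divides_mull/rank1.
have -> : (v ^t* *m eval_mx A e *m v) 0 0 = g.@[eC].
  rewrite mxE /g rmorph_sum /=.
  under eq_bigr do rewrite mxE mulr_suml.
  rewrite exchange_big; apply: eq_bigr => j _; rewrite rmorph_sum /=.
  apply: eq_bigr => k _; rewrite !mxE mevalZ mulrAC; congr (_ * _).
  by apply: meval_eq => i; rewrite mxE.
have [r r0 bezout] := line_bezout eC coprime F0.
(* the base point of the line has natural coordinates [N i] *)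
have [N rhN] : exists N : 'I_3 -> nat, (r * h).@[fun i => (N i)%:R] != 0.
  by apply: mpoly_nonvanishing; rewrite mulf_neq0.
pose a : 'rV[R]_3 := \row_i (N i)%:R; pose aC := rc \o a 0.
have {rhN} [ra ha] : r.@[aC] != 0 /\ h.@[aC] != 0.
  apply/andP; rewrite -negb_or -mulf_eq0 -mevalM; move: rhN; congr (_ != 0).
  by apply: meval_eq => i; rewrite /aC /= mxE rmorph_nat.
have lineR (p : {mpoly R[3]}) :
    map_poly rc (restrict_line p e a) = line_poly eC aC (complexify p).
  exact: line_poly_map.
have lf : map_poly rc (restrict_line f e a) = line_poly eC aC F by exact: lineR.
have la : map_poly rc (restrict_line a11 e a) = line_poly eC aC (A i0 i0).
  by rewrite A11; exact: lineR.
have topR (p : {mpoly R[3]}) k : p \is k.-homog ->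
    (size (restrict_line p e a) <= k.+1)%N /\ (restrict_line p e a)`_k = p.@[e 0].
  exact: line_poly_top.
have [sp cp] := topR _ _ f_homog; have [_ cq] := topR _ _ a11_hom.
have h_hom : h \is n.-homog by apply: rpred_sum => k _; apply: rpredZ.
have g_hom : g \is n.-homog.
  by apply: rpred_sum => j _; apply: rpred_sum => k _; apply: rpredZ.
have [sh _] := line_poly_top eC aC h_hom.
have [sg cg] := line_poly_top eC aC g_hom.
rewrite -cg -cq; apply: (interlacing_square_coef (inter a) _ _ _ sh sg
  (w := line_poly eC aC w)).
- apply/eqP; rewrite eqn_leq sp ltnNge; apply: contra fe0 => sp'.
  by rewrite -cp nth_default.
- move=> x fx; apply/negP => qx; have [u [t]] := bezout aC.
  rewrite -lf -la => /(congr1 (fun p : {poly C} => p.[rc x])).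
  rewrite hornerD !hornerM hornerC.
  rewrite (horner_map rc (restrict_line f e a) x).
  rewrite (horner_map rc (restrict_line a11 e a) x).
  by rewrite /= (eqP fx) (eqP qx) rmorph0 !mulr0 addr0 => /esym/eqP; rewrite (negPf ra).
- apply: contraNneq ha => h00.
  have <- : h.@[fun i => 0 * eC i + aC i] = h.@[aC].
    by apply: meval_eq => i; rewrite mul0r add0r.
  by rewrite -horner_line_poly h00 horner0.
- have E : conj_mpoly h * h = A i0 i0 * g + w * F by rewrite -Ew addrC subrK.
  rewrite line_poly_conj lf la.
  transitivity (line_poly eC aC (conj_mpoly h * h)); first by rewrite rmorphM.
  by rewrite E rmorphD /=; congr (_ + _); rewrite rmorphM.
Qed.

End RankOne.
End Definiteness.

(** * Definiteness of the adjugate *)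

Section DefiniteAdjugate.
Local Open Scope sesquilinear_scope.
Variables (R : realType) (n : nat).
Local Notation C := R[i].
Implicit Types B : 'M[C]_n.+1.

Lemma trmxC_mul (m k l : nat) (A : 'M[C]_(m, k)) (B : 'M[C]_(k, l)) :
  (A *m B) ^t* = B ^t* *m A ^t*.
Proof. by rewrite trmx_mul map_mxM. Qed.

Lemma det_herm_real B : B ^t* = B -> \det B \is Num.real.
Proof.
move=> hB; apply/CrealP; rewrite -{2}hB.
by rewrite (det_map_mx (Num.conj : {rmorphism C -> C})) det_tr.
Qed.

Lemma adj_herm B : B ^t* = B -> (\adj B) ^t* = \adj B.
Proof.
move=> hB; rewrite trmx_adj (map_mx_adj (Num.conj : {rmorphism C -> C})).
by rewrite hB.
Qed.

(** With [v = B w], the form [v^* (\adj B) v] equals [\det B] times [w^* B w]. *)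
Lemma definite_adj B (s k : C) :
  B ^t* = B -> s \is Num.real -> k \is Num.real -> k != 0 ->
  (forall v : 'cV[C]_n.+1, v != 0 -> 0 < s * (v ^t* *m B *m v) 0 0) ->
  \det B != 0 /\ definite (k *: \adj B).
Proof.
move=> hB sR kR k0 pos.
have dB0 : \det B != 0.
  apply/negP => /det0P[v v0 vB].
  have := pos (v ^t*); rewrite trmxCK vB mul0mx mxE mulr0 ltxx.
  have -> : v ^t* != 0.
    by apply: contraNneq v0 => v'0; rewrite -[v]trmxCK v'0 trmx0 map_mx0.
  by move/(_ isT).
have s0 : s != 0.
  have one0 : const_mx 1 != 0 :> 'cV[C]_n.+1.
    by apply/eqP => /matrixP/(_ 0 0)/eqP; rewrite !mxE oner_eq0.
  by apply: contraTneq (pos _ one0) => ->; rewrite mul0r ltxx.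
have dBR := det_herm_real hB.
have form v : exists2 w : 'cV[C]_n.+1, v = B *m w &
    (v ^t* *m (k *: \adj B) *m v) 0 0 =
    (k * \det B / s) * (s * (w ^t* *m B *m w) 0 0).
  have Bu : B \in unitmx by rewrite unitmxE unitfE.
  exists (invmx B *m v); first by rewrite mulKVmx.
  rewrite mulrA divfK //; set w := invmx B *m v.
  have {1 2}-> : v = B *m w by rewrite mulKVmx.
  rewrite trmxC_mul hB -!mulmxA -scalemxAl mulmxA.
  rewrite (mulmxA _ B w) mul_adj_mx mul_scalar_mx.
  by rewrite scalerA -!scalemxAr mxE mulmxA.
have rR : k * \det B / s \is Num.real by rewrite !rpredM // rpredV.
have r0 : k * \det B / s != 0 by rewrite !mulf_neq0 // invr_eq0.
split=> //; split.
  apply/is_hermitianmxP; rewrite expr0 scale1r linearZ /= map_mxZ /=.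
  by rewrite (adj_herm hB) (CrealP kR).
have w0 (v w : 'cV[C]_n.+1) : v != 0 -> v = B *m w -> w != 0.
  by move=> v0 E; apply: contraNneq v0 => w0; rewrite E w0 mulmx0.
have [rpos|rneg] : 0 < k * \det B / s \/ k * \det B / s < 0.
- by case/real_ltgt0P: rR r0 => // _ _; [left|right].
- left=> v v0; have [w Ew ->] := form v.
  by rewrite mulr_gt0 // pos // (w0 v).
- right=> v v0; have [w Ew ->] := form v.
  by rewrite nmulr_rlt0 // pos // (w0 v).
Qed.

End DefiniteAdjugate.

Section DixonFacts.
Variable R : realType.
Local Notation C := R[i].

Lemma smooth_neq0 (F : {mpoly C[3]}) : smooth_curve F -> F != 0.
Proof.
move=> smF; apply: contraTneq isT => F0.
have nrm : @normalized R (\row_i (i == 0)%:R).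
  apply/existsP; exists 0; rewrite mxE eqxx /=; apply/andP; split => //.
  by apply/forallP.
have [|i] := smF (Point nrm); first by rewrite /on_curve F0 meval0.
by rewrite F0 mderiv0 meval0 eqxx.
Qed.

Lemma divides_conj (f : {mpoly R[3]}) p :
  divides (complexify f) p -> divides (complexify f) (conj_mpoly p).
Proof.
by case=> w ->; exists (conj_mpoly w); rewrite rmorphM /= conj_complexify.
Qed.

Lemma dixon_hermitian n (d_gt0 : (0 < n.+1)%N) (f : {mpoly R[3]}) D
    (A : 'M[{mpoly C[3]}]_n.+1) :
  dixon_matrix d_gt0 f D A -> forall j k, A k j = conj_mpoly (A j k).
Proof.
move=> dA j k; have [jk|kj|jk] := ssrnat.ltngtP j k.
- exact: (dixon_lower dA jk).
- by rewrite (dixon_lower dA kj) conj_mpolyK.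
have -> : k = j by apply: val_inj.
have [j0|j0] := posnP j.
  have -> : j = Ordinal d_gt0 by apply: val_inj.
  by have [a [_ -> _]] := dixon_a11 dA; rewrite conj_complexify.
by have [a ->] := dixon_diag_real dA j0; rewrite conj_complexify.
Qed.

Lemma dixon_homog n (d_gt0 : (0 < n.+1)%N) (f : {mpoly R[3]}) D
    (A : 'M[{mpoly C[3]}]_n.+1) :
  dixon_matrix d_gt0 f D A -> forall j k, A j k \is n.-homog.
Proof.
move=> dA.
have upper (j k : 'I_n.+1) : (j <= k)%N -> A j k \is n.-homog.
  move=> jk; have [j0|j0] := posnP j; last by apply: (dixon_upper_homog dA); rewrite j0.
  have -> : j = Ordinal d_gt0 by apply: val_inj.
  exact: (dixon_row_space dA k).1.
move=> j k; have [jk|kj] := ssrnat.leqP j k; first exact: upper.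
by rewrite (dixon_hermitian dA k j); apply/map_mpoly_homog/upper/ltnW.
Qed.

(** The construction imposes the congruence for [j <= k] only; the other half is
    its complex conjugate. *)
Lemma dixon_rank1 n (d_gt0 : (0 < n.+1)%N) (f : {mpoly R[3]}) D
    (A : 'M[{mpoly C[3]}]_n.+1) (i0 := Ordinal d_gt0) :
  dixon_matrix d_gt0 f D A -> forall j k,
  divides (complexify f) (conj_mpoly (A i0 j) * A i0 k - A i0 i0 * A j k).
Proof.
move=> dA j k.
have herm := dixon_hermitian dA.
have [j0|j0] := posnP j.
  have -> : j = i0 by apply: val_inj.
  by rewrite -herm subrr; exact: divides0.
have [k0|k0] := posnP k.
  have -> : k = i0 by apply: val_inj.
  by rewrite -herm mulrC subrr; exact: divides0.
have [jk|kj] := ssrnat.leqP j k; first by apply: (dixon_upper_mod dA); rewrite j0.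
have /(dixon_upper_mod dA)/divides_conj : (0 < k <= j)%N by rewrite k0 ltnW.
by rewrite rmorphB !rmorphM /= conj_mpolyK -!herm mulrC.
Qed.

End DixonFacts.

(** * The determinantal representation *)

Theorem theorem4p6 (R : realType) (d : nat) (d_gt0 : (0 < d)%N)
    (f : {mpoly R[3]}) (f_homog : f \is d.-homog)
    (f_smooth : smooth_curve (complexify f))
    (D : {freeg (point R)}) (D_contact : real_contact f D)
    (D_deg : deg D = 'C(d, 2)%:Z)
    (A : 'M[{mpoly R[i][3]}]_d) (A_dixon : dixon_matrix d_gt0 f D A) :
  ((2 <= d)%N -> forall j k, mdvd (complexify f ^+ (d - 2)) (\adj A j k)) /\
  exists M : 'M[{mpoly R[i][3]}]_d,
    [/\ dixon_quotient (complexify f) A M,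
        forall j k, M j k \is 1.-homog
      & exists gamma : R,
          complexify (gamma *: f) = \det M /\
          forall (e : 'rV[R]_3) (a11 : {mpoly R[3]}),
            hyperbolic f e ->
            A (Ordinal d_gt0) (Ordinal d_gt0) = complexify a11 ->
            interlaces d a11 f e ->
            gamma != 0 /\ definite (eval_mx M e)].
Proof.
case: d d_gt0 f_homog D_deg A A_dixon => // n d_gt0 f_homog _ A dA.
pose i0 : 'I_n.+1 := Ordinal d_gt0; set F := complexify f.
have F0 : F != 0 := smooth_neq0 f_smooth.
have herm := dixon_hermitian dA.
have homA := dixon_homog dA.
have rank1 := dixon_rank1 dA.
have cop : nonzerodiv_mod F (A i0 i0).
  have [a [_ _ [ncf _]]] := dixon_a11 dA; exact: no_common_factorP ncf.
have F_homog : F \is n.+1.-homog by exact: map_mpoly_homog.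
have [M [c [EM homM detA detM]]] := adjugate_quotient F0 F_homog cop homA rank1.
have quot : dixon_quotient F A M.
  rewrite /dixon_quotient eqSS subSS subn1; move: EM.
  case: eqP => [n0|_]; last by rewrite scale1r.
  have -> : n.-1 = 0%N by rewrite n0.
  by rewrite expr0 scale1r.
(* [A] is Hermitian, so [\det A = c F^n] is fixed by conjugation, and [F] is real *)
have [g Ec] : exists g : R, c = real_complex R g.
  have detAC : conj_mpoly (\det A) = \det A.
    rewrite -(det_map_mx (@conj_mpoly R)) -[RHS]det_tr; congr (\det _).
    by apply/matrixP => j k; rewrite !mxE (herm j k).
  suff /complex_realP[g ->] : c \is Num.real by exists g.
  apply/CrealP; apply: (can_inj (@mpolyCK 3 _)).
  apply: (mulIf (expf_neq0 n F0)); rewrite -detA -detAC detA rmorphM rmorphXn /=.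
  by rewrite conj_mpolyC conj_complexify.
split.
  move=> d2 j k; have n0 : (n == 0%N) = false by apply/negbTE; rewrite -lt0n.
  exists (M j k); rewrite subSS subn1 mulrC.
  by have /matrixP/(_ j k) := EM; rewrite n0 scale1r !mxE => ->.
exists M; split=> //; exists (g ^+ n); split.
  rewrite detM Ec -rmorphXn /= mul_mpolyC; exact: map_mpolyZ.
move=> e a11 [fe0 _] A11 inter.
pose ev : {rmorphism {mpoly R[i][3]} -> R[i]} := meval (map_mx (real_complex R) e 0).
have evF : ev F = real_complex R f.@[e 0].
  by rewrite -meval_complexify; apply: meval_eq => i; rewrite mxE.
have evF0 : ev F != 0 by rewrite evF fmorph_eq0.
(* [M(e)] is [kappa] times the adjugate of [A(e)]; the conditional is the case
   [d = 1], where [M] carries a factor [F] instead of a denominator *)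
pose kappa := (ev F ^+ n.-1)^-1 * (if n == 0%N then ev F else 1).
have evM : eval_mx M e = kappa *: \adj (eval_mx A e).
  rewrite -[eval_mx A e]/(map_mx ev A) -(map_mx_adj ev) -scalerA.
  have -> : (if n == 0%N then ev F else 1) = ev (if n == 0%N then F else 1).
    by case: ifP => _; rewrite ?rmorph1.
  rewrite -map_mxZ -EM map_mxZ rmorphXn scalerA mulVf ?scale1r //.
  by rewrite expf_neq0.
have kappa0 : kappa != 0.
  by rewrite mulf_neq0 ?invr_eq0 ?expf_neq0 //; case: ifP; rewrite ?oner_eq0.
have kappaR : kappa \is Num.real.
  have FR : ev F \is Num.real by rewrite evF; apply/complex_realP; exists f.@[e 0].
  by rewrite realM ?realV ?realX //; case: ifP.
have sR : real_complex R a11.@[e 0] \is Num.real.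
  by apply/complex_realP; exists a11.@[e 0].
have [detB0 defM] := definite_adj (eval_mx_herm e herm) sR kappaR kappa0 (fun v =>
  @interlacing_hermitian_gt0 R n f a11 A i0 A11 homA rank1 cop
    (@dixon_row_free _ _ _ _ _ _ dA) f_homog e v fe0 inter).
rewrite evM; split=> //; apply: contraNneq detB0 => gn0.
rewrite -[eval_mx A e]/(map_mx ev A) det_map_mx detA rmorphM /=.
have n0 : (0 < n)%N.
  by rewrite lt0n; apply: contra_eqN gn0 => /eqP ->; rewrite expr0 oner_eq0.
have g0 : g = 0 by move/eqP: gn0; rewrite expf_eq0 n0 => /eqP.
by rewrite Ec g0 !rmorph0 mul0r.
Qed.
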